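(* $\textsc{Nephew}\in\mathsf{TFZPP}\cap\mathsf{PWPP}$.
   Context: $\textsc{Nephew}$: the input is a set $V=\{0,1\}^n$ and two functions $f,g:V\to V$ given as Boolean circuits; a solution is any $u\in V$ such that $f(f(g(u)))\neq f(u)$ or $f(g(u))=u$. (This problem is total.) $\mathsf{TFZPP}$ is the class of total $\mathsf{NP}$ search problems solvable by a distribution over polynomial-time algorithms that, on every input, either output a valid solution or $\bot$, outputting $\bot$ with probability at most $1/3$. $\textsc{Weak-Pigeon}$: given a circuit $h:\{0,1\}^n\to\{0,1\}^{n-1}$, find $x\neq y$ with $h(x)=h(y)$. $\mathsf{PWPP}$ is the class of total search problems polynomial-time many-one reducible to $\textsc{Weak-Pigeon}$. *)

(* Defs.v *)
From HB Require Import structures.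
From mathcomp Require Import all_boot all_order all_algebra.
Set Implicit Arguments.
Unset Strict Implicit.
Unset Printing Implicit Defensive.
Import Order.TTheory GRing.Theory Num.Theory.

Inductive move := MoveL | MoveR | Stay.

(* [None] is the blank; [inl b] is the bit [b]; [inr a] is one of finitely many
   further work symbols. *)
Definition symbol (A : Type) := option (bool + A).

(* Two-way infinite tape: cells left of the head (nearest first), then the
   scanned cell followed by the cells to its right; all cells beyond the two
   lists are blank. *)
Definition tape (A : Type) : Type := seq (symbol A) * seq (symbol A).

Definition tape_read A (t : tape A) : symbol A := head None t.2.

Definition tape_write A (s : symbol A) (t : tape A) : tape A :=
  (t.1, s :: behead t.2).

Definition tape_move A (d : move) (t : tape A) : tape A :=
  match d with
  | MoveL => (behead t.1, head None t.1 :: t.2)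
  | MoveR => (head None t.2 :: t.1, behead t.2)
  | Stay => t
  end.

Record tm := TM {
  tm_tapes : nat;  (* number of tapes, minus one *)
  tm_extra : finType;
  tm_state : finType;
  tm_start : tm_state;
  tm_halt : pred tm_state;
  tm_delta : tm_state -> {ffun 'I_tm_tapes.+1 -> symbol tm_extra} ->
             tm_state * ('I_tm_tapes.+1 -> symbol tm_extra * move) }.

Definition config (M : tm) : Type :=
  tm_state M * {ffun 'I_(tm_tapes M).+1 -> tape (tm_extra M)}.

Definition tm_step (M : tm) (c : config M) : config M :=
  if tm_halt c.1 then c else
  let a := tm_delta c.1 [ffun i => tape_read (c.2 i)] in
  (a.1, [ffun i => tape_move (a.2 i).2 (tape_write (a.2 i).1 (c.2 i))]).

(* The [i]-th input string is on the [i]-th tape, head on its first bit. *)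
Definition tm_init (M : tm) (xs : seq (seq bool)) : config M :=
  (tm_start M,
   [ffun i : 'I_(tm_tapes M).+1 =>
      ([::], [seq Some (inl b) | b <- nth [::] xs i])]).

Fixpoint leading_bits A (s : seq (symbol A)) : seq bool :=
  if s is Some (inl b) :: s' then b :: leading_bits s' else [::].

(* The output is the maximal bit string starting at the head of tape 0. *)
Definition tm_output (M : tm) (c : config M) : seq bool :=
  leading_bits (c.2 ord0).2.

Definition tm_computes_within (M : tm) (xs : seq (seq bool)) (T : nat)
    (y : seq bool) : Prop :=
  let c := iter T (@tm_step M) (tm_init M xs) in
  tm_halt c.1 /\ tm_output c = y.

(* Every polynomial is bounded by [poly_bound c] for some [c]. *)
Definition poly_bound (c n : nat) : nat := n ^ c + c.

Definition poly_time1 (F : seq bool -> seq bool) : Prop :=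
  exists (M : tm) (c : nat), forall x,
    tm_computes_within M [:: x] (poly_bound c (size x)) (F x).

Definition poly_time2 (F : seq bool -> seq bool -> seq bool) : Prop :=
  exists (M : tm) (c : nat), forall x y,
    tm_computes_within M [:: x; y] (poly_bound c (size x + size y)) (F x y).

(* [R x y]: the string [y] is a solution of the input string [x]. *)
Definition search_problem := seq bool -> seq bool -> Prop.

Definition TFNP (R : search_problem) : Prop :=
  [/\ forall x, exists y, R x y,
      exists c, forall x y, R x y -> size y <= poly_bound c (size x)
    & exists2 v : seq bool -> seq bool -> bool,
        poly_time2 (fun x y => [:: v x y]) & forall x y, R x y <-> v x y].

Definition poly_reducible (R S : search_problem) : Prop :=
  exists (F : seq bool -> seq bool) (G : seq bool -> seq bool -> seq bool),
    [/\ poly_time1 F, poly_time2 G & forall x y, S (F x) y -> R x (G x y)].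

(* Probability of [P] over [m] independent uniform bits. *)
Definition prob_bits (m : nat) (P : pred (m.-tuple bool)) : rat :=
  (#|[set r | P r]|%:R / (2 ^ m)%:R)%R.

(* [None] is the answer "bottom". *)
Definition enc_option (o : option (seq bool)) : seq bool :=
  if o is Some y then true :: y else [::].

(* [A x r] is the answer on input [x] with random bits [r]. *)
Definition TFZPP (R : search_problem) : Prop :=
  TFNP R /\
  exists (A : seq bool -> seq bool -> option (seq bool)) (c : nat),
    [/\ poly_time2 (fun x r => enc_option (A x r)),
        forall x (r : (poly_bound c (size x)).-tuple bool) y,
          A x r = Some y -> R x y
      & forall x,
          (prob_bits (fun r : (poly_bound c (size x)).-tuple bool =>
                        A x r == None) <= 1 / 3%:R)%R].

(* A circuit is a straight-line program.  Its wires are the inputs and the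
   gates; a gate refers to a wire by its position in the list of all wires
   preceding the gate, most recent first, the inputs [u_0, ..., u_(n-1)]
   forming the initial list in this order. *)
Inductive gate :=
  | Const of bool
  | Not of nat
  | And of nat & nat
  | Or of nat & nat.

Definition gate_wf (k : nat) (g : gate) : bool :=
  match g with
  | Const _ => true
  | Not i => i < k
  | And i j | Or i j => (i < k) && (j < k)
  end.

Fixpoint gates_wf (k : nat) (gs : seq gate) : bool :=
  if gs is g :: gs' then gate_wf k g && gates_wf k.+1 gs' else true.

Definition gate_val (w : seq bool) (g : gate) : bool :=
  match g with
  | Const b => b
  | Not i => ~~ nth false w i
  | And i j => nth false w i && nth false w j
  | Or i j => nth false w i || nth false w j
  end.

Fixpoint gates_wires (w : seq bool) (gs : seq gate) : seq bool :=
  if gs is g :: gs' then gates_wires (gate_val w g :: w) gs' else w.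

(* The outputs of a circuit with [m] outputs are its [m] most recent wires. *)
Record circuit (n m : nat) := Circuit {
  circuit_gates : seq gate;
  circuit_wf : gates_wf n circuit_gates && (m <= n + size circuit_gates) }.

Definition circuit_eval n m (C : circuit n m) (u : n.-tuple bool) :
    m.-tuple bool :=
  [tuple nth false (gates_wires u (circuit_gates C)) i | i < m].

Coercion circuit_eval : circuit >-> Funclass.

Definition enc_nat (n : nat) : seq bool := rcons (nseq n true) false.

Definition enc_gate (g : gate) : seq bool :=
  match g with
  | Const b => [:: false; false; b]
  | Not i => [:: false; true] ++ enc_nat i
  | And i j => [:: true; false] ++ enc_nat i ++ enc_nat j
  | Or i j => [:: true; true] ++ enc_nat i ++ enc_nat j
  end.

Definition enc_gates (gs : seq gate) : seq bool :=
  rcons (flatten [seq true :: enc_gate g | g <- gs]) false.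

Definition enc_circuit n m (C : circuit n m) : seq bool :=
  enc_gates (circuit_gates C).

(* The search problem on strings given by encoded instances.  A string that
   encodes no instance has the empty string as its only solution. *)
Definition encoded_problem (I : Type) (enc : I -> seq bool)
    (sol : I -> seq bool -> Prop) : search_problem := fun x y =>
  (exists2 i, x = enc i & sol i y) \/ ((forall i, x <> enc i) /\ y = [::]).

Record nephew_instance := NephewInstance {
  nephew_dim : nat;
  nephew_f : circuit nephew_dim nephew_dim;
  nephew_g : circuit nephew_dim nephew_dim }.

Definition enc_nephew (i : nephew_instance) : seq bool :=
  enc_nat (nephew_dim i) ++ enc_circuit (nephew_f i) ++ enc_circuit (nephew_g i).

Definition nephew_solution (i : nephew_instance) (y : seq bool) : Prop :=
  let f := nephew_f i in
  let g := nephew_g i in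
  exists2 u : (nephew_dim i).-tuple bool, y = u &
    f (f (g u)) <> f u \/ f (g u) = u.

Definition Nephew : search_problem := encoded_problem enc_nephew nephew_solution.

(* The circuit has [n] inputs and [n - 1] outputs, where
   [n = (weak_pigeon_dim i).+1]. *)
Record weak_pigeon_instance := WeakPigeonInstance {
  weak_pigeon_dim : nat;
  weak_pigeon_h : circuit weak_pigeon_dim.+1 weak_pigeon_dim }.

Definition enc_weak_pigeon (i : weak_pigeon_instance) : seq bool :=
  enc_nat (weak_pigeon_dim i) ++ enc_circuit (weak_pigeon_h i).

Definition weak_pigeon_solution (i : weak_pigeon_instance) (z : seq bool) :
    Prop :=
  let h := weak_pigeon_h i in
  exists x y : (weak_pigeon_dim i).+1.-tuple bool,
    [/\ z = x ++ y, x <> y & h x = h y].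

Definition WeakPigeon : search_problem :=
  encoded_problem enc_weak_pigeon weak_pigeon_solution.

Definition PWPP (R : search_problem) : Prop :=
  TFNP R /\ poly_reducible R WeakPigeon.

(* Main.v *)
From mathcomp Require Import all_boot all_order all_algebra.
From mathcomp Require Import zify.
Require Import Defs.
Set Implicit Arguments.
Unset Strict Implicit.
Unset Printing Implicit Defensive.
Import Order.TTheory GRing.Theory Num.Theory.

(* From a non-solution [u] there are two ways to move: to [g u] or to [g v],
   where [v = f (g u)].  If neither [u] nor [v] is a solution, both moves
   satisfy [f (f (next u)) = f u], while [f (g u) = v <> f (g v)].  Hence two
   walks of equal length from the zero string that never meet a solution and
   end with the same value of [f] made the same choices: the map sending the
   choices [r] to [f] of the endpoint is injective on the unsuccessful [r].
   So at most [2 ^ n] choice strings are unsuccessful, which makes a random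
   walk of length [n + 2] succeed with probability at least 3/4; and for [n + 1]
   choices that map is an instance of Weak-Pigeon whose collisions lead to
   solutions.

   Turing machines are built from structured programs on stacks, each tape
   being a stack of bits, and these from functions on binary trees written in
   prefix notation on a single stack. *)

(** * Stack machines on Turing tapes *)

Record mach := Mach {
  mstate : finType;
  mstart : mstate;
  mtape : mstate -> nat;
  mdelta : mstate -> symbol void -> option mstate * (symbol void * move) }.

Definition tape_act (k : nat) (a : symbol void * move) (t : nat -> tape void)
    (j : nat) : tape void :=
  if j == k then tape_move a.2 (tape_write a.1 (t j))
  else tape_write (tape_read (t j)) (t j).

Inductive run (M : mach) :
    mstate M -> (nat -> tape void) -> nat -> (nat -> tape void) -> Prop :=
  | RunExit q t a :
      mdelta q (tape_read (t (mtape q))) = (None, a) ->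
      run q t 1 (tape_act (mtape q) a t)
  | RunStep q t q' a n t' :
      mdelta q (tape_read (t (mtape q))) = (Some q', a) ->
      run q' (tape_act (mtape q) a t) n t' ->
      run q t n.+1 t'.

Notation store := (nat -> seq bool).

Definition repr (s : store) (t : nat -> tape void) : Prop :=
  forall j, exists m, (t j).2 = [seq Some (inl b) | b <- s j] ++ nseq m None.

Definition computes (M : mach) (s : store) (n : nat) (s' : store) : Prop :=
  forall t, repr s t ->
  exists n' t', [/\ n' <= n, run (mstart M) t n' t' & repr s' t'].

Definition upd (s : store) (k : nat) (v : seq bool) : store :=
  fun j => if j == k then v else s j.

Lemma computes_weaken M s n1 n2 s1 s2 :
  computes M s n1 s1 -> n1 <= n2 -> s1 =1 s2 -> computes M s n2 s2.
Proof.
move=> h le_n eq_s t /h[n [t' [le_n' r rp]]].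
exists n, t'; split=> //; first exact: leq_trans le_n.
by move=> j; case: (rp j) => m; rewrite eq_s; exists m.
Qed.

Lemma computes_eq_pre M s s1 n s2 : s =1 s1 -> computes M s1 n s2 ->
  computes M s n s2.
Proof.
move=> eq_s h t rp; apply: h => j.
by case: (rp j) => m; rewrite eq_s; exists m.
Qed.

Definition top (x : symbol void) : option bool :=
  if x is Some (inl b) then Some b else None.

Lemma top_read s t j : repr s t -> top (tape_read (t j)) = ohead (s j).
Proof.
by move=> /(_ j)[m]; rewrite /tape_read => ->; case: (s j) => //; case: m.
Qed.

Lemma repr_rewrite s t k :
  repr s t -> repr s (tape_act k (tape_read (t k), Stay) t).
Proof.
move=> rp j; rewrite /tape_act; case: (rp j) => m e.
have -> : (if j == k then tape_move (tape_read (t k), Stay).2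
     (tape_write (tape_read (t k), Stay).1 (t j)) else
     tape_write (tape_read (t j)) (t j)) = tape_write (tape_read (t j)) (t j).
  by case: eqP => [->|].
rewrite /tape_write /tape_read /= e.
by case: (s j) => [|b u]; [exists m.-1.+1; case: m {e} | exists m].
Qed.

Definition mskip : mach :=
  @Mach unit tt (fun=> 0) (fun _ x => (None, (x, Stay))).

Definition mpop (k : nat) : mach :=
  @Mach unit tt (fun=> k) (fun _ x => (None, (x, MoveR))).

Definition mpush (b : bool) (k : nat) : mach :=
  @Mach bool false (fun=> k) (fun q x =>
    if q then (None, (Some (inl b), Stay)) else (Some true, (x, MoveL))).

Definition mseq (M1 M2 : mach) : mach :=
  @Mach (mstate M1 + mstate M2)%type (inl (mstart M1))
    (fun q => match q with inl q => mtape q | inr q => mtape q end)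
    (fun q x => match q with
     | inl q => let r := mdelta q x in
                (Some (if r.1 is Some q' then inl q' else inr (mstart M2)), r.2)
     | inr q => let r := mdelta q x in (omap inr r.1, r.2) end).

Definition mif (P : pred (option bool)) (k : nat) (M1 M2 : mach) : mach :=
  @Mach (option (mstate M1 + mstate M2)%type) None
    (fun q => match q with
     | None => k | Some (inl q) => mtape q | Some (inr q) => mtape q end)
    (fun q x => match q with
     | None => (Some (Some (if P (top x) then inl (mstart M1)
                            else inr (mstart M2))), (x, Stay))
     | Some (inl q) => let r := mdelta q x in
                       (omap (fun q' => Some (inl q')) r.1, r.2)
     | Some (inr q) => let r := mdelta q x in
                       (omap (fun q' => Some (inr q')) r.1, r.2) end).

Definition mwhile (P : pred (option bool)) (k : nat) (M : mach) : mach :=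
  @Mach (option (mstate M)) None
    (fun q => if q is Some q then mtape q else k)
    (fun q x => match q with
     | None => (if P (top x) then Some (Some (mstart M)) else None, (x, Stay))
     | Some q => let r := mdelta q x in (Some r.1, r.2) end).

Lemma computes_skip s : computes mskip s 1 s.
Proof.
move=> t rp; exists 1, (tape_act 0 (tape_read (t 0), Stay) t); split=> //.
  exact: (@RunExit mskip).
exact: repr_rewrite.
Qed.

Lemma computes_pop k s : computes (mpop k) s 1 (upd s k (behead (s k))).
Proof.
move=> t rp; exists 1, (tape_act k (tape_read (t k), MoveR) t); split=> //.
  exact: (@RunExit (mpop k)).
move=> j; case: (repr_rewrite k rp j) => m; rewrite /tape_act /upd.
case: eqP => [->|_] /=; last by move->; exists m.
case: (rp k) => m1; rewrite /tape_write /= /tape_read => -> _.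
by case: (s k) => [|b u]; [exists m1.-1; case: m1 | exists m1].
Qed.

Lemma computes_push b k s : computes (mpush b k) s 2 (upd s k (b :: s k)).
Proof.
move=> t rp; pose t1 := tape_act k (tape_read (t k), MoveL) t.
exists 2, (tape_act k (Some (inl b), Stay) t1); split=> //.
  apply: (@RunStep (mpush b k) false t true (tape_read (t k), MoveL)) => //.
  exact: (@RunExit (mpush b k) true).
move=> j; case: (repr_rewrite k rp j) => m; rewrite /tape_act /t1 /tape_act.
rewrite /upd; case: eqP => [->|_] /= e; last first.
  by exists m; move: e; rewrite /tape_read /tape_write /=.
by exists m; rewrite -e.
Qed.

Lemma run_seq2 M1 M2 (q : mstate M2) t n t' :
  run q t n t' -> run (M := mseq M1 M2) (inr q) t n t'.
Proof.
elim=> {q t n t'} [q t a e | q t q' a n t' e _ IH].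
  by apply: (@RunExit (mseq M1 M2) (inr q)); rewrite /= e.
by apply: (@RunStep (mseq M1 M2) (inr q) t (inr q')) IH; rewrite /= e.
Qed.

Lemma run_seq1 M1 M2 (q : mstate M1) t n t' n2 t2 :
  run q t n t' -> run (M := mseq M1 M2) (inr (mstart M2)) t' n2 t2 ->
  run (M := mseq M1 M2) (inl q) t (n + n2) t2.
Proof.
move=> r r2; elim: r r2 => {q t n t'} [q t a e | q t q' a n t' e _ IH] r2.
  rewrite add1n.
  by apply: (@RunStep (mseq M1 M2) (inl q) _ (inr (mstart M2)) a) r2;
    rewrite /= e.
rewrite addSn.
by apply: (@RunStep (mseq M1 M2) (inl q) t (inl q') a) (IH r2); rewrite /= e.
Qed.

Lemma computes_seq M1 M2 s s1 s2 n m :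
  computes M1 s n s1 -> computes M2 s1 m s2 -> computes (mseq M1 M2) s (n + m)
    s2.
Proof.
move=> h1 h2 t /h1[n1 [t1 [le1 r1 /h2[n2 [t2 [le2 r2 rp2]]]]]].
exists (n1 + n2), t2; split=> //; first exact: leq_add.
exact: run_seq1 r1 (run_seq2 _ r2).
Qed.

Lemma run_if1 P k M1 M2 (q : mstate M1) t n t' :
  run q t n t' -> run (M := mif P k M1 M2) (Some (inl q)) t n t'.
Proof.
elim=> {q t n t'} [q t a e | q t q' a n t' e _ IH].
  by apply: (@RunExit (mif P k M1 M2) (Some (inl q))); rewrite /= e.
apply: (@RunStep (mif P k M1 M2) (Some (inl q)) t (Some (inl q'))) IH.
by rewrite /= e.
Qed.

Lemma run_if2 P k M1 M2 (q : mstate M2) t n t' :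
  run q t n t' -> run (M := mif P k M1 M2) (Some (inr q)) t n t'.
Proof.
elim=> {q t n t'} [q t a e | q t q' a n t' e _ IH].
  by apply: (@RunExit (mif P k M1 M2) (Some (inr q))); rewrite /= e.
apply: (@RunStep (mif P k M1 M2) (Some (inr q)) t (Some (inr q'))) IH.
by rewrite /= e.
Qed.

Lemma computes_if (P : pred (option bool)) k M1 M2 s s' n :
  (if P (ohead (s k)) then computes M1 s n s' else computes M2 s n s') ->
  computes (mif P k M1 M2) s n.+1 s'.
Proof.
move=> h t rp; pose t1 := tape_act k (tape_read (t k), Stay) t.
have rp1 : repr s t1 by exact: repr_rewrite.
have e := top_read k rp.
case: ifP h => Pk h; case: (h _ rp1) => [n' [t' [le_n r rp']]].
  exists n'.+1, t'; split=> //.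
  apply: (@RunStep (mif P k M1 M2) None _ (Some (inl (mstart M1)))).
    by rewrite /= e Pk.
  exact: run_if1.
exists n'.+1, t'; split=> //.
apply: (@RunStep (mif P k M1 M2) None _ (Some (inr (mstart M2)))).
  by rewrite /= e Pk.
exact: run_if2.
Qed.

Lemma computes_while_stop (P : pred (option bool)) k M s :
  ~~ P (ohead (s k)) -> computes (mwhile P k M) s 1 s.
Proof.
move=> nP t rp; exists 1, (tape_act k (tape_read (t k), Stay) t); split=> //.
  apply: (@RunExit (mwhile P k M) None).
  by rewrite /= (top_read _ rp) (negPf nP).
exact: repr_rewrite.
Qed.

Lemma run_while P k M (q : mstate M) t n t' n2 t2 :
  run q t n t' -> run (M := mwhile P k M) None t' n2 t2 ->
  run (M := mwhile P k M) (Some q) t (n + n2) t2.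
Proof.
move=> r r2; elim: r r2 => {q t n t'} [q t a e | q t q' a n t' e _ IH] r2.
  rewrite add1n.
  by apply: (@RunStep (mwhile P k M) (Some q) _ None a) r2; rewrite /= e.
rewrite addSn.
by apply: (@RunStep (mwhile P k M) (Some q) t (Some q') a) (IH r2);
  rewrite /= e.
Qed.

Lemma computes_while_step (P : pred (option bool)) k M s s1 s2 n m :
  P (ohead (s k)) -> computes M s n s1 -> computes (mwhile P k M) s1 m s2 ->
  computes (mwhile P k M) s (n + m).+1 s2.
Proof.
move=> Pk h h2 t rp; pose t1 := tape_act k (tape_read (t k), Stay) t.
have rp1 : repr s t1 by exact: repr_rewrite.
have [n1 [t' [le1 r1 /h2[n2 [t2 [le2 r2 rp2]]]]]] := h _ rp1.
exists (n1 + n2).+1, t2; split=> //; first by rewrite ltnS leq_add.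
apply: (@RunStep (mwhile P k M) None _ (Some (mstart M))).
  by rewrite /= (top_read _ rp) Pk.
exact: run_while r1 r2.
Qed.

Section ToTM.
Variable M : mach.

Definition tapes_bound := \max_(q : mstate M) mtape q.

Definition tm_of : tm :=
  @TM tapes_bound void (option (mstate M)) (Some (mstart M))
    (fun q => q == None)
    (fun q a => match q with
     | None => (None, fun i => (a i, Stay))
     | Some q => let r := mdelta q (a (inord (mtape q))) in
       (r.1, fun i : 'I_tapes_bound.+1 =>
               if i == mtape q :> nat then r.2 else (a i, Stay)) end).

Definition tm_conf (q : option (mstate M)) (t : nat -> tape void) :
  config tm_of := (q, [ffun i : 'I_tapes_bound.+1 => t i]).

Lemma tm_of_step q t :
  let r := mdelta q (tape_read (t (mtape q))) in
  tm_step (tm_conf (Some q) t) = tm_conf r.1 (tape_act (mtape q) r.2 t).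
Proof.
have lt_q : mtape q < tapes_bound.+1 by rewrite ltnS; exact: leq_bigmax.
rewrite /tm_step /= !ffunE inordK //; congr (_, _).
apply/ffunP => i; rewrite !ffunE /tape_act.
by case: eqP => // ->.
Qed.

Lemma run_tm q t n t' : run q t n t' ->
  iter n (@tm_step tm_of) (tm_conf (Some q) t) = tm_conf None t'.
Proof.
elim=> {q t n t'} [q t a e | q t q' a n t' e _ IH].
  by rewrite /= tm_of_step e.
by rewrite iterSr tm_of_step e.
Qed.

Lemma leading_bits_stack (y : seq bool) m :
  leading_bits ([seq Some (inl b) | b <- y] ++ nseq m None : seq (symbol void))
  = y.
Proof. by elim: y => [|b y IH] /=; [case: m | rewrite IH]. Qed.

Lemma computes_tm (xs : seq (seq bool)) n y s' :
  computes M (nth [::] xs) n s' -> s' 0 = y -> tm_computes_within tm_of xs n y.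
Proof.
move=> h e; pose t j : tape void := ([::], [seq Some (inl b)
  | b <- nth [::] xs j]).
have [|n' [t' [le_n r rp]]] := h t.
  by move=> j; exists 0; rewrite cats0.
have E : iter n (@tm_step tm_of) (tm_init tm_of xs) = tm_conf None t'.
  rewrite -(subnK le_n) iterD.
  rewrite (_ : tm_init _ _ = tm_conf (Some (mstart M)) t) // (run_tm r).
  by elim: (n - n') => //= m ->.
rewrite /tm_computes_within E; split=> //.
rewrite /tm_output /= ffunE /=.
by case: (rp 0) => m ->; rewrite e leading_bits_stack.
Qed.

End ToTM.

Arguments computes_skip : clear implicits.
Arguments computes_pop : clear implicits.
Arguments computes_push : clear implicits.

(** * Elementary stack machines *)

Ltac solve_upd :=
  rewrite /upd; repeat (case: eqP => ?); subst; try (exfalso; lia); try done.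

Definition is_true_top : pred (option bool) := fun x => x == Some true.

Definition mdrain (k : nat) (M : bool -> mach) : mach :=
  mwhile isSome k (mif is_true_top k (mseq (mpop k) (M true))
                                     (mseq (mpop k) (M false))).

Lemma computes_drain k M (St : seq bool -> seq bool -> store) n l :
  (forall u v, St u v k = v) ->
  (forall u b v, u ++ b :: v = l ->
     computes (M b) (upd (St u (b :: v)) k v) n (St (rcons u b) v)) ->
  computes (mdrain k M) (St [::] l) (size l * (n + 3)).+1 (St l [::]).
Proof.
move=> Stk h.
suff: forall v u, u ++ v = l ->
    computes (mdrain k M) (St u v) (size v * (n + 3)).+1 (St (u ++ v) [::]).
  exact.
elim=> [|b v IH] u eq_l /=.
  by rewrite cats0; apply: computes_while_stop; rewrite Stk.
apply: (@computes_weaken _ _ ((n + 2) + (size v * (n + 3)).+1).+1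
         _ (St (rcons u b ++ v) [::])); first last.
- by rewrite cat_rcons.
- lia.
apply: computes_while_step (IH (rcons u b) _); first by rewrite Stk.
  rewrite addn2; apply: computes_if; rewrite Stk /=.
  have := computes_seq (computes_pop k (St u (b :: v))) _.
  rewrite Stk /= => /(_ _ _ _ (h u b v eq_l)).
  by case: (b).
by rewrite cat_rcons.
Qed.

Definition mrevmove (i j : nat) : mach := mdrain i (fun b => mpush b j).

Lemma computes_revmove s i j l r : i <> j -> s i = l -> s j = r ->
  computes (mrevmove i j) s (size l * 5).+1 (upd (upd s i [::]) j (rev l ++ r)).
Proof.
move=> ne_ij si sj.
pose St u v := upd (upd s i v) j (rev u ++ r).
apply: (computes_eq_pre (s1 := St [::] l)); first by move=> x; rewrite /St;
  solve_upd.
apply: (computes_drain (St := St) (n := 2)) => [u v | u b v _].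
  by rewrite /St; solve_upd.
apply: computes_weaken (computes_push b j _) _ _ => // x; rewrite /St;
  solve_upd.
by rewrite rev_rcons.
Qed.

Definition mclear (i : nat) : mach := mdrain i (fun=> mskip).

Lemma computes_clear s i l : s i = l ->
  computes (mclear i) s (size l * 4).+1 (upd s i [::]).
Proof.
move=> si; pose St (u : seq bool) v := upd s i v.
apply: (computes_eq_pre (s1 := St [::] l)); first by move=> x; rewrite /St;
  solve_upd.
apply: (computes_drain (St := St) (n := 1)) => [u v | u b v _].
  by rewrite /St; solve_upd.
by apply: computes_weaken (computes_skip _) _ _ => // x; rewrite /St; solve_upd.
Qed.

Definition mrevmove2 (i j k : nat) : mach :=
  mdrain i (fun b => mseq (mpush b j) (mpush b k)).

Lemma computes_revmove2 s i j k l r q : i <> j -> i <> k -> j <> k ->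
  s i = l -> s j = r -> s k = q ->
  computes (mrevmove2 i j k) s (size l * 7).+1
       (upd (upd (upd s i [::]) j (rev l ++ r)) k (rev l ++ q)).
Proof.
move=> ij ik jk si sj sk.
pose St u v := upd (upd (upd s i v) j (rev u ++ r)) k (rev u ++ q).
apply: (computes_eq_pre (s1 := St [::] l)); first by move=> x; rewrite /St;
  solve_upd.
apply: (computes_drain (St := St) (n := 4)) => [u v | u b v _].
  by rewrite /St; solve_upd.
apply: computes_weaken (computes_seq (computes_push b j _)
  (computes_push b k _)) _ _ => // x.
by rewrite /St; solve_upd; rewrite rev_rcons.
Qed.

Definition mcopy (k j i : nat) : mach := mseq (mrevmove k i) (mrevmove2 i k j).

Lemma computes_copy s k j i l : k <> j -> k <> i -> j <> i ->
  s k = l -> s j = [::] -> s i = [::] ->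
  computes (mcopy k j i) s (size l * 12 + 2) (upd s j l).
Proof.
move=> kj ki ji sk sj si.
apply: computes_weaken.
- apply: computes_seq; first exact: (computes_revmove ki sk si).
  by apply: (@computes_revmove2 _ i k j (rev l) [::] [::]); try lia; solve_upd;
    rewrite cats0.
- by rewrite size_rev; lia.
- by move=> x; solve_upd; rewrite revK cats0.
Qed.

Definition mmove (i j t : nat) : mach := mseq (mrevmove i t) (mrevmove t j).

Lemma computes_move s i j t l r : i <> j -> i <> t -> j <> t ->
  s i = l -> s j = r -> s t = [::] ->
  computes (mmove i j t) s (size l * 10 + 2) (upd (upd s i [::]) j (l ++ r)).
Proof.
move=> ij it jt si sj st.
apply: computes_weaken.
- apply: computes_seq; first exact: (computes_revmove it si st).
  by apply: (@computes_revmove _ t j (rev l) r); try lia; solve_upd;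
    rewrite cats0.
- by rewrite size_rev; lia.
- by move=> x; solve_upd; rewrite revK.
Qed.

Fixpoint mpushs (l : seq bool) (k : nat) : mach :=
  if l is b :: l' then mseq (mpushs l' k) (mpush b k) else mskip.

Lemma computes_pushs l k s :
  computes (mpushs l k) s (size l * 2).+1 (upd s k (l ++ s k)).
Proof.
elim: l => [|b l IH] /=.
  by apply: computes_weaken (computes_skip s) _ _ => // x; solve_upd.
apply: computes_weaken (computes_seq IH (computes_push b k _)) _ _; first lia.
by move=> x; solve_upd.
Qed.

Arguments computes_pushs : clear implicits.

Inductive tree := Leaf | Node of tree & tree.

Fixpoint str (t : tree) : seq bool :=
  if t is Node l r then true :: str l ++ str r else [:: false].

Definition msplit_loop (k d c : nat) : mach :=
  mwhile isSome c
    (mif is_true_top k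
      (mseq (mpop k) (mseq (mpush true d) (mpush true c)))
      (mseq (mpop k) (mseq (mpush false d) (mpop c)))).

Lemma computes_split_loop k d c : k <> d -> k <> c -> d <> c ->
  forall t s v w r m s2, s k = str t ++ v -> s c = true :: w -> s d = r ->
  computes (msplit_loop k d c)
    (upd (upd (upd s k v) c w) d (rev (str t) ++ r)) m s2 ->
  computes (msplit_loop k d c) s (size (str t) * 7 + m) s2.
Proof.
move=> kd kc dc; elim=> [|t1 IH1 t2 IH2] s v w r m s2 sk sc sd h.
  apply: (@computes_weaken _ _ (5 + m).+1 _ s2) => //.
  apply: computes_while_step h; first by rewrite sc.
  apply: (@computes_weaken _ _ (1 + (2 + 1)).+1 _ _); first last.
  - by [].
  - by [].
  apply: computes_if; rewrite sk /=.
  apply: computes_seq; first exact: computes_pop.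
  apply: computes_weaken (computes_seq (computes_push false d _)
    (computes_pop c _)) _ _ => //.
  by move=> x; solve_upd; rewrite ?sk ?sc ?sd.
apply: (@computes_weaken _ _
  (6 + (size (str t1) * 7 + (size (str t2) * 7 + m))).+1 _ s2) => //;
    last first.
  by rewrite /= size_cat; lia.
pose s1 := upd (upd (upd s k (str t1 ++ (str t2 ++ v))) d (true :: r)) c
               (true :: true :: w).
apply: (@computes_while_step _ _ _ _ s1); first by rewrite sc.
  apply: (@computes_weaken _ _ (1 + (2 + 2)).+1 _ _); first last.
  - by [].
  - by [].
  apply: computes_if; rewrite sk /=.
  apply: computes_seq; first exact: computes_pop.
  apply: computes_weaken (computes_seq (computes_push true d _)
    (computes_push true c _)) _ _ => //.
  by move=> x; rewrite /s1; solve_upd; rewrite ?sk ?sc ?sd //= catA.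
apply: (IH1 _ (str t2 ++ v) (true :: w) (true :: r)); try by rewrite /s1;
  solve_upd.
apply: (IH2 _ v w (rev (str t1) ++ true :: r)); try by rewrite /s1; solve_upd.
apply: computes_eq_pre h => x; rewrite /s1; solve_upd.
by rewrite /= rev_cons rev_cat -cats1 -!catA.
Qed.

Definition munpair (k : nat) : mach :=
  mseq (mpop k) (mseq (mpush true k.+1)
    (mseq (msplit_loop k k.+2 k.+1) (mrevmove k.+2 k.+1))).

Definition empty_above (k : nat) (s : store) := forall j, k < j -> s j = [::].

Lemma computes_unpair k s t1 t2 : s k = str (Node t1 t2) -> empty_above k s ->
  computes (munpair k) s (size (str t1) * 12 + 5)
    (upd (upd s k (str t2)) k.+1 (str t1)).
Proof.
move=> sk e; have e1 := e k.+1 (ltnSn k); have e2 := e k.+2 (leqnSn _).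
apply: computes_weaken.
- apply: computes_seq; first exact: computes_pop.
  apply: computes_seq; first exact: computes_push.
  apply: computes_seq.
    apply: (@computes_split_loop k k.+2 k.+1 _ _ _ t1 _ (str t2) [::] [::]);
      try lia; try by solve_upd; rewrite ?sk ?e1.
    by apply: computes_while_stop; solve_upd.
  by apply: (@computes_revmove _ k.+2 k.+1 (rev (str t1)) [::]); try lia;
    solve_upd;
    rewrite cats0.
- by rewrite size_rev; lia.
- by move=> x; solve_upd; rewrite revK cats0.
Qed.

Definition mmerge (x y t u : nat) : mach :=
  mseq (mrevmove x t) (mseq (mmove y x u) (mseq (mrevmove t x) (mpush true x))).

Lemma computes_merge s x y t u lx ly :
  x <> y -> x <> t -> x <> u -> y <> t -> y <> u -> t <> u ->
  s x = lx -> s y = ly -> s t = [::] -> s u = [::] ->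
  computes (mmerge x y t u) s (size lx * 10 + size ly * 10 + 6)
    (upd (upd s y [::]) x (true :: lx ++ ly)).
Proof.
move=> xy xt xu yt yu tu sx sy st su.
apply: computes_weaken.
- apply: computes_seq; first by apply: (computes_revmove xt sx st).
  apply: computes_seq.
    by apply: (@computes_move _ y x u ly [::]); try lia; solve_upd.
  apply: computes_seq.
    by apply: (@computes_revmove _ t x (rev lx) ly); try lia; solve_upd;
      rewrite cats0.
  exact: computes_push.
- by rewrite size_rev; lia.
- by move=> z; solve_upd; rewrite revK.
Qed.

(** * Polynomial-time functions on encoded data *)

Definition polyb (q : nat -> nat) : Prop :=
  exists c, forall n, q n <= poly_bound c n.

Lemma poly_bound_mono c m n : m <= n -> poly_bound c m <= poly_bound c n.
Proof.
by rewrite leq_add2r; case: c => [|c] // le_mn; rewrite leq_exp2r.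
Qed.

Lemma polybP q : polyb q <-> exists d, forall n, 1 < n -> q n <= n ^ d.
Proof.
split=> [[c h]|[d h]].
  exists c.+1 => n n_gt1; apply: leq_trans (h n) _; rewrite /poly_bound expnS.
  have := ltn_expl c n_gt1; nia.
exists (d + q 0 + q 1) => -[|[|n]]; rewrite /poly_bound; try lia.
apply: (leq_trans (h n.+2 isT)); apply: leq_trans (leq_addr _ _).
by rewrite leq_pexp2l // -addnA leq_addr.
Qed.

Lemma polyb_id : polyb id.
Proof. by exists 1 => n; rewrite /poly_bound expn1 leq_addr. Qed.

Lemma polyb_const c : polyb (fun=> c).
Proof. by exists c => n; rewrite leq_addl. Qed.

Lemma polyb_add q1 q2 : polyb q1 -> polyb q2 -> polyb (fun n => q1 n + q2 n).
Proof.
move=> /polybP[a ha] /polybP[b hb]; apply/polybP; exists (a + b).+1 => n n_gt1.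
have := ha n n_gt1; have := hb n n_gt1; rewrite expnS expnD.
have n_gt0 := ltnW n_gt1.
have := leq_pmulr (n ^ a) (_ : 0 < n ^ b); rewrite expn_gt0 n_gt0.
have := leq_pmull (n ^ b) (_ : 0 < n ^ a); rewrite expn_gt0 n_gt0.
move=> /(_ isT) le1 /(_ isT) le2.
have := leq_mul n_gt1 (leqnn (n ^ a * n ^ b)); lia.
Qed.

Lemma polyb_mul q1 q2 : polyb q1 -> polyb q2 -> polyb (fun n => q1 n * q2 n).
Proof.
move=> /polybP[a ha] /polybP[b hb]; apply/polybP; exists (a + b) => n n_gt1.
by rewrite expnD leq_mul ?ha ?hb.
Qed.

Lemma polyb_poly_bound c q : polyb q -> polyb (fun n => poly_bound c (q n)).
Proof.
move=> /polybP[a ha].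
have [|d hd] := (polybP (poly_bound c)).1; first by exists c.
apply/polybP; exists (a.+1 * d) => n n_gt1.
apply: leq_trans (poly_bound_mono c (n := n ^ a.+1) _) _.
  by apply: leq_trans (ha n n_gt1) _; rewrite leq_pexp2l //; lia.
by rewrite expnM hd // -(exp1n a.+1) ltn_exp2r.
Qed.

Ltac polyb :=
  repeat first [ exact: polyb_id | exact: polyb_const | apply: polyb_poly_bound
               | apply: polyb_add | apply: polyb_mul ].

Class Enc (A : Type) := code : A -> tree.

Definition sz {A} {_ : Enc A} (a : A) : nat := size (str (code a)).

#[export] Instance enc_tree : Enc tree := id.
#[export] Instance enc_unit : Enc unit := fun=> Leaf.
#[export] Instance enc_bool : Enc bool := fun b =>
  if b then Node Leaf Leaf else Leaf.
#[export] Instance enc_prod A B `{Enc A} `{Enc B} : Enc (A * B) :=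
  fun p => Node (code p.1) (code p.2).
#[export] Instance enc_nat_tree : Enc nat := fun n => iter n (Node Leaf) Leaf.
#[export] Instance enc_seq A `{Enc A} : Enc (seq A) :=
  fix c l := if l is x :: l' then Node (code x) (c l') else Leaf.
#[export] Instance enc_opt A `{Enc A} : Enc (option A) :=
  fun o => if o is Some x then Node (code x) Leaf else Leaf.

Lemma sz_gt0 A `{Enc A} (a : A) : 0 < sz a.
Proof. by rewrite /sz; case: code. Qed.

Lemma sz_pair A B `{Enc A} `{Enc B} (a : A) (b : B) : sz (a, b)
  = (sz a + sz b).+1.
Proof. by rewrite /sz /= size_cat. Qed.

Lemma sz_nil A `{Enc A} : sz (Nil A) = 1.
Proof. by []. Qed.

Lemma sz_cons A `{Enc A} x (l : seq A) : sz (x :: l) = (sz x + sz l).+1.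
Proof. by rewrite /sz /= size_cat. Qed.

Lemma sz_nat (n : nat) : sz n = n.*2.+1.
Proof. by rewrite /sz /code /enc_nat_tree; elim: n => //= n ->. Qed.

Definition polytime {A B} `{Enc A} `{Enc B} (f : A -> B) : Prop :=
  exists c, (forall a, sz (f a) <= poly_bound c (sz a)) /\
  forall k, exists M, forall s a, s k = str (code a) -> empty_above k s ->
    computes M s (poly_bound c (sz a)) (upd s k (str (code (f a)))).

Lemma polytime_intro A B `{Enc A} `{Enc B} (f : A -> B) q : polyb q ->
  (forall a, sz (f a) <= q (sz a)) ->
  (forall k, exists M, forall s a, s k = str (code a) -> empty_above k s ->
    computes M s (q (sz a)) (upd s k (str (code (f a))))) -> polytime f.
Proof.
move=> [c hc] szf h; exists c; split=> [a|k].
  exact: leq_trans (hc _).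
have [M hM] := h k; exists M => s a sk e.
exact: computes_weaken (hM s a sk e) (hc _) _.
Qed.

Lemma polytime_eq A B `{Enc A} `{Enc B} (f g : A -> B) : f =1 g ->
  polytime f -> polytime g.
Proof.
move=> eq_fg [c [szf h]]; exists c; split=> [a|k]; first by rewrite -eq_fg.
have [M hM] := h k; exists M => s a sk e.
by rewrite -eq_fg; apply: hM.
Qed.

(* The code of an object carries no type, so a conversion that preserves codes
   costs nothing. *)
Lemma polytime_cast A B `{Enc A} `{Enc B} (f : A -> B) :
  (forall a, code (f a) = code a) -> polytime f.
Proof.
move=> cf; apply: (polytime_intro (q := id)); first exact: polyb_id.
  by move=> a; rewrite /sz cf.
move=> k; exists mskip => s a sk _.
apply: computes_weaken (computes_skip s) _ _; first exact: sz_gt0.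
by move=> x; rewrite cf; solve_upd.
Qed.

Lemma polytime_id A `{Enc A} : polytime (fun a : A => a).
Proof. exact: polytime_cast. Qed.

Lemma polytime_comp A B C `{Enc A} `{Enc B} `{Enc C} (g : B -> C) (f : A -> B) :
  polytime g -> polytime f -> polytime (fun a => g (f a)).
Proof.
move=> [c2 [szg hg]] [c1 [szf hf]].
pose q n := poly_bound c1 n + poly_bound c2 (poly_bound c1 n).
have le_g a : poly_bound c2 (sz (f a)) <= poly_bound c2 (poly_bound c1 (sz a)).
  exact: poly_bound_mono.
apply: (polytime_intro (q := q)); first by rewrite /q; polyb.
  by move=> a; apply: leq_trans (szg _) _; rewrite /q; have := le_g a; lia.
move=> k; have [Mf hMf] := hf k; have [Mg hMg] := hg k.
exists (mseq Mf Mg) => s a sk e.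
apply: computes_weaken.
- apply: computes_seq; first exact: hMf sk e.
  apply: (hMg _ (f a)); first by solve_upd.
  by move=> j ltj; solve_upd; apply: e.
- by rewrite /q; have := le_g a; lia.
- by move=> x; solve_upd.
Qed.

Lemma polytime_const A B `{Enc A} `{Enc B} (b : B) : polytime (fun _ : A => b).
Proof.
apply: (polytime_intro (q := fun n => n * 4 + (sz b * 2 + 2))); first by polyb.
  by move=> a; lia.
move=> k; exists (mseq (mclear k) (mpushs (str (code b)) k)) => s a sk e.
apply: computes_weaken.
- by apply: computes_seq; [exact: computes_clear sk | exact: computes_pushs].
- by rewrite -/(sz a) -/(sz b); lia.
- by move=> x; solve_upd; rewrite cats0.
Qed.

Lemma polytime_pair A B C `{Enc A} `{Enc B} `{Enc C} (f : A -> B) (g : A -> C) :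
  polytime f -> polytime g -> polytime (fun a => (f a, g a)).
Proof.
move=> [c1 [szf hf]] [c2 [szg hg]].
pose q n := n * 28 + ((poly_bound c1 n + poly_bound c2 n) * 21 + 30).
apply: (polytime_intro (q := q)); first by rewrite /q; polyb.
  by move=> a; rewrite sz_pair /q; have := szf a; have := szg a; lia.
move=> k; have [Mf hMf] := hf k.+1; have [Mg hMg] := hg k.+2.
exists (mseq (mcopy k k.+1 k.+2) (mseq Mf (mseq (mcopy k k.+2 k.+3)
  (mseq Mg (mseq (mclear k) (mseq (mmerge k.+1 k.+2 k.+3 k.+4)
    (mmove k.+1 k k.+2))))))) => s a sk e.
apply: computes_weaken.
- apply: computes_seq.
    by apply: (computes_copy _ _ _ sk); try lia; apply: e; lia.
  apply: computes_seq.
    apply: (hMf _ a); first by solve_upd.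
    by move=> j ltj; solve_upd; apply: e; lia.
  apply: computes_seq.
    by apply: (@computes_copy _ k k.+2 k.+3 (str (code a))); try lia; solve_upd;
      apply: e; lia.
  apply: computes_seq.
    apply: (hMg _ a); first by solve_upd.
    by move=> j ltj; solve_upd; apply: e; lia.
  apply: computes_seq.
    by apply: (@computes_clear _ k (str (code a))); solve_upd.
  apply: computes_seq.
    by apply: (@computes_merge _ k.+1 k.+2 k.+3 k.+4 (str (code (f a)))
      (str (code (g a)))); try lia; solve_upd; apply: e; lia.
  by apply: (@computes_move _ k.+1 k k.+2 (str (code (f a, g a))) [::]);
    try lia;
    solve_upd; apply: e; lia.
- move: (szf a) (szg a); rewrite /= size_cat /q -!/(sz _) /sz.
  lia.
- by move=> x; solve_upd; rewrite ?cats0 // e //; lia.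
Qed.

Lemma polytime_fst0 A B `{Enc A} `{Enc B} : polytime (fun p : A * B => p.1).
Proof.
apply: (polytime_intro (q := fun n => n * 30 + 10)); first by polyb.
  by case=> a b; rewrite sz_pair /=; lia.
move=> k; exists (mseq (munpair k) (mseq (mclear k) (mmove k.+1 k k.+2))).
move=> s [a b] sk e /=.
apply: computes_weaken.
- apply: computes_seq; first by apply: (computes_unpair sk e).
  apply: computes_seq.
    by apply: (@computes_clear _ k (str (code b))); solve_upd.
  by apply: (@computes_move _ k.+1 k k.+2 (str (code a)) [::]); try lia;
    solve_upd;
    apply: e; lia.
- rewrite sz_pair /sz /=; lia.
- by move=> x; solve_upd; rewrite ?cats0 // e //; lia.
Qed.

Lemma polytime_snd0 A B `{Enc A} `{Enc B} : polytime (fun p : A * B => p.2).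
Proof.
apply: (polytime_intro (q := fun n => n * 30 + 10)); first by polyb.
  by case=> a b; rewrite sz_pair /=; lia.
move=> k; exists (mseq (munpair k) (mclear k.+1)).
move=> s [a b] sk e /=.
apply: computes_weaken.
- apply: computes_seq; first by apply: (computes_unpair sk e).
  by apply: (@computes_clear _ k.+1 (str (code a))); solve_upd.
- rewrite sz_pair /sz /=; lia.
- by move=> x; solve_upd; rewrite ?cats0 // e //; lia.
Qed.

Lemma polytime_fst A B C `{Enc A} `{Enc B} `{Enc C} (f : A -> B * C) :
  polytime f -> polytime (fun a => (f a).1).
Proof. exact: (polytime_comp polytime_fst0). Qed.

Lemma polytime_snd A B C `{Enc A} `{Enc B} `{Enc C} (f : A -> B * C) :
  polytime f -> polytime (fun a => (f a).2).
Proof. exact: (polytime_comp polytime_snd0). Qed.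

(* Covers the case analysis on lists, numbers, options and booleans: in each of
   these types exactly one constructor is coded by a leaf. *)
Lemma polytime_case A B C D `{Enc A} `{Enc B} `{Enc C} `{Enc D}
    (l : A -> B) (f : A -> C) (g : A * D -> C) (h : A -> C) :
  (forall a, match code (l a) with
             | Leaf => h a = f a
             | _ => exists2 d : D, code d = code (l a) & h a = g (a, d)
             end) ->
  polytime l -> polytime f -> polytime g -> polytime h.
Proof.
move=> hE [cl [szl hl]] [cf [szf hf]] [cg [szg hg]].
pose q n := n * 22 + (poly_bound cl n * 11 + (poly_bound cf n +
  (poly_bound cg (n + (poly_bound cl n + 1)) + 20))).
have le_g a d : code d = code (l a) -> poly_bound cg (sz (a, d)) <=
    poly_bound cg (sz a + (poly_bound cl (sz a) + 1)).
  move=> ed; apply: poly_bound_mono; rewrite sz_pair [sz d]/sz ed -/(sz (l a)).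
  by have := szl a; lia.
apply: (polytime_intro (q := q)); first by rewrite /q; polyb.
  move=> a; have := hE a; have := le_g a.
  case: (code (l a)) => [|t1 t2] hle.
    by move->; rewrite /q; have := szf a; lia.
  by case=> d ed ->; have := hle d ed; have := szg (a, d); rewrite /q; lia.
move=> k; have [Ml hMl] := hl k.+1; have [Mf hMf] := hf k.
have [Mg hMg] := hg k.
exists (mseq (mcopy k k.+1 k.+2) (mseq Ml (mif is_true_top k.+1
   (mseq (mmerge k k.+1 k.+2 k.+3) Mg) (mseq (mpop k.+1) Mf)))) => s a sk e.
have := szl a; have := hE a; have := le_g a.
case cl_a: (code (l a)) => [|t1 t2] hle hh leL.
  apply: computes_weaken.
  - apply: computes_seq.
      by apply: (computes_copy _ _ _ sk); try lia; apply: e; lia.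
    apply: computes_seq.
      apply: (hMl _ a); first by solve_upd.
      by move=> j ltj; solve_upd; apply: e; lia.
    apply: computes_if; rewrite {1}/upd eqxx cl_a /=.
    apply: computes_seq; first exact: computes_pop.
    apply: (hMf _ a); first by solve_upd.
    by move=> j ltj; solve_upd; try (apply: e; lia); rewrite cl_a.
  - by rewrite /q -/(sz a); lia.
  - by move=> x; solve_upd; rewrite ?cl_a ?hh ?e.
case: hh => d ed hh; have {}hle := hle d ed.
apply: computes_weaken.
- apply: computes_seq.
    by apply: (computes_copy _ _ _ sk); try lia; apply: e; lia.
  apply: computes_seq.
    apply: (hMl _ a); first by solve_upd.
    by move=> j ltj; solve_upd; apply: e; lia.
  apply: computes_if; rewrite {1}/upd eqxx cl_a /=.
  apply: computes_seq.
    by apply: (@computes_merge _ k k.+1 k.+2 k.+3 (str (code a))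
      (str (code d)));
      try lia; solve_upd; try (apply: e; lia); rewrite ed.
  apply: (hMg _ (a, d)); first by solve_upd.
  by move=> j ltj; solve_upd; apply: e; lia.
- have : sz d = sz (l a) by rewrite /sz ed cl_a.
  by move: leL hle; rewrite /q -!/(sz _) => *; lia.
- by move=> x; solve_upd; rewrite -?hh // e.
Qed.

Lemma polytime_loop A B `{EA : Enc A} `{Enc B} (f : A -> A) c : polytime f ->
  (forall a n, sz (iter n f a) <= poly_bound c (sz a + n)) ->
  polytime (fun p : A * B => iter (sz p.2) f p.1).
Proof.
move=> [cf [szf hf]] hc.
pose q n := n * 12 + (n * (poly_bound cf (poly_bound c (n + n)) + 3) +
  (poly_bound c (n + n) * 10 + 20)).
apply: (polytime_intro (q := q)); first by rewrite /q; polyb.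
  case=> a b; rewrite sz_pair /=; apply: leq_trans (hc a (sz b)) _.
  set N := (sz a + sz b).+1.
  have : poly_bound c (sz a + sz b) <= poly_bound c (N + N).
    by apply: poly_bound_mono; lia.
  by rewrite /q; lia.
move=> k; have [Mf hMf] := hf k.+1.
exists (mseq (munpair k) (mseq (mdrain k (fun=> Mf)) (mmove k.+1 k k.+2))).
move=> s [a b] sk e.
pose St (u : seq bool) v :=
  upd (upd s k v) k.+1 (str (@code A EA (iter (size u) f a))).
have [N eN] : exists N, N = (sz a + sz b).+1 by exists (sz a + sz b).+1.
have le_c m : m <= sz b -> sz (iter m f a) <= poly_bound c (N + N).
  move=> le_m; apply: leq_trans (hc a m) _.
  by apply: poly_bound_mono; lia.
apply: computes_weaken.
- apply: computes_seq; first by apply: (computes_unpair sk e).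
  apply: computes_seq.
    apply: (computes_eq_pre (s1 := St [::] (str (code b)))).
      by move=> x; rewrite /St; solve_upd.
    apply: (computes_drain (St := St) (n := poly_bound cf (poly_bound c (N +
      N)))).
      by move=> u v; rewrite /St; solve_upd.
    move=> u b' v eq_l.
    have le_u : size u <= sz b by rewrite /sz -eq_l size_cat; lia.
    apply: computes_weaken (hMf _ (iter (size u) f a) _ _) _ _.
    - by rewrite /St; solve_upd.
    - by move=> j ltj; rewrite /St; solve_upd; apply: e; lia.
    - by apply: poly_bound_mono; apply: le_c.
    - by move=> x; rewrite /St size_rcons iterS; solve_upd.
  by apply: (@computes_move _ k.+1 k k.+2 (str (code (iter (sz b) f a))) [::]);
    try lia; rewrite /St; solve_upd; apply: e; lia.
- move: (le_c (sz b) (leqnn _)); rewrite /q sz_pair -eN -!/(sz _) -!/(sz b) /=.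
  set T := poly_bound cf _ + 3.
  have : sz b * T <= N * T by rewrite leq_mul2r eN; lia.
  lia.
- move=> x; rewrite /St; solve_upd; rewrite ?cats0 // ?e //; lia.
Qed.

(** * Input and output *)

Definition mencode (j t : nat) : mach :=
  mseq (mrevmove j t) (mseq (mpush false j)
    (mdrain t (fun b => mpushs (if b then [:: true; true; false; false]
                                else [:: true; false]) j))).

Lemma sz_bits (l : seq bool) : sz l <= size l * 4 + 1.
Proof. by elim: l => //= b l IH; rewrite sz_cons [sz b]/sz; case: b => /=;
  lia. Qed.

Lemma computes_encode s j t l : j <> t -> s j = l -> s t = [::] ->
  computes (mencode j t) s (size l * 17 + 4) (upd s j (str (code l))).
Proof.
move=> jt sj st.
pose St u (v : seq bool) := upd (upd s t v) j (str (@code _ (@enc_seq bool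
  enc_bool) (rev u))).
apply: computes_weaken.
- apply: computes_seq; first exact: (computes_revmove jt sj st).
  apply: computes_seq; first exact: computes_push.
  apply: (computes_eq_pre (s1 := St [::] (rev l))).
    by move=> x; rewrite /St; solve_upd; rewrite cats0.
  apply: (computes_drain (St := St) (n := 9)) => [u v | u b v _].
    by rewrite /St; solve_upd.
  apply: computes_weaken (computes_pushs _ j _) _ _; first by case: b.
  by move=> x; rewrite /St rev_rcons; case: b; solve_upd.
- by rewrite size_rev; lia.
- by move=> x; rewrite /St revK; solve_upd.
Qed.

Definition mdecode_loop : mach :=
  mwhile is_true_top 0 (mseq (mpop 0) (mif is_true_top 0
    (mseq (mpop 0) (mseq (mpop 0) (mseq (mpop 0) (mpush true 1))))
    (mseq (mpop 0) (mpush false 1)))).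

Definition mdecode : mach :=
  mseq mdecode_loop (mseq (mpop 0) (mrevmove 1 0)).

Lemma computes_decode_loop (l : seq bool) s r : s 0 = str (code l) -> s 1 = r ->
  computes mdecode_loop s (size l * 8 + 1)
    (upd (upd s 0 [:: false]) 1 (rev l ++ r)).
Proof.
elim: l s r => [|b l IH] s r s0 s1 /=.
  apply: computes_weaken (computes_while_stop _ _) _ _; first by rewrite s0.
    by [].
  by move=> x; solve_upd.
apply: (@computes_weaken _ _ (7 + (size l * 8 + 1)).+1); [|lia|by []].
apply: (@computes_while_step _ _ _ _ (upd (upd s 0 (str (code l))) 1 (b :: r))).
- by rewrite s0.
- apply: (@computes_weaken _ _ (1 + 6)); [|by []|by []].
  apply: computes_seq; first exact: computes_pop.
  apply: computes_if; rewrite {1}/upd s0 /=; case: b s0 => /= s0.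
    apply: (@computes_weaken _ _ (1 + (1 + (1 + 2))) _
                         (upd (upd s 0 (str (code l))) 1 (true :: r))) => //.
    apply: computes_seq; first exact: computes_pop.
    apply: computes_seq; first exact: computes_pop.
    apply: computes_seq; first exact: computes_pop.
    apply: computes_weaken (computes_push _ _ _) _ _ => // x.
    by solve_upd; rewrite ?s0 ?s1.
  apply: (@computes_weaken _ _ (1 + 2) _
                       (upd (upd s 0 (str (code l))) 1 (false :: r))) => //.
  apply: computes_seq; first exact: computes_pop.
  apply: computes_weaken (computes_push _ _ _) _ _ => // x.
  by solve_upd; rewrite ?s0 ?s1.
- apply: computes_weaken (IH _ (b :: r) _ _) _ _ => // x.
  by rewrite rev_cons cat_rcons; solve_upd.
Qed.

Lemma computes_decode (l : seq bool) s : s 0 = str (code l) -> s 1 = [::] ->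
  computes mdecode s (size l * 13 + 3) (upd s 0 l).
Proof.
move=> s0 s1; apply: computes_weaken.
- apply: computes_seq; first exact: (computes_decode_loop s0 s1).
  apply: computes_seq; first exact: computes_pop.
  by apply: (@computes_revmove _ 1 0 (rev l) [::]); solve_upd; rewrite cats0.
- by rewrite size_rev; lia.
- by move=> x; solve_upd; rewrite revK cats0.
Qed.

Lemma leq_size_sz A `{Enc A} (l : seq A) : size l <= sz l.
Proof. by elim: l => //= x l IH; rewrite sz_cons; lia. Qed.

Lemma polytime_poly_time1 (F : seq bool -> seq bool) : polytime F ->
  poly_time1 F.
Proof.
move=> [c [szF /(_ 0)[M hM]]].
pose q n := n * 17 + 4 + (poly_bound c (n * 4 + 1) * 14 + 3).
have [d hd] : polyb q by rewrite /q; polyb.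
pose M' := mseq (mencode 0 1) (mseq M mdecode).
exists (tm_of M'), d => x.
have le_c : poly_bound c (sz x) <= poly_bound c (size x * 4 + 1).
  exact: poly_bound_mono (sz_bits x).
apply: (computes_tm (s' := upd (nth [::] [:: x]) 0 (F x))); last by [].
apply: computes_weaken.
- apply: computes_seq; first by apply: (@computes_encode _ 0 1 x).
  apply: computes_seq.
    apply: (hM _ x); first by solve_upd.
    by move=> [|j] // _; solve_upd; rewrite /= nth_nil.
  by apply: (@computes_decode (F x)); solve_upd.
- apply: leq_trans (hd (size x)); rewrite /q.
  have le_F : size (F x) <= sz (F x) by exact: leq_size_sz.
  by have := szF x; lia.
- by move=> j; solve_upd.
Qed.

Lemma polytime_poly_time2 (F : seq bool -> seq bool -> seq bool) :
  polytime (fun p => F p.1 p.2) -> poly_time2 F.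
Proof.
move=> [c [szF /(_ 0)[M hM]]].
pose q n := n * 80 + 50 + (poly_bound c (n * 4 + 3) * 14 + 3).
have [d hd] : polyb q by rewrite /q; polyb.
pose M' := mseq (mencode 0 2) (mseq (mencode 1 2) (mseq (mmerge 0 1 2 3)
  (mseq M mdecode))).
exists (tm_of M'), d => x y.
have le_c : poly_bound c (sz (x, y)) <= poly_bound c ((size x + size y)
  * 4 + 3).
  apply: poly_bound_mono; rewrite sz_pair.
  by have := sz_bits x; have := sz_bits y; lia.
apply: (computes_tm (s' := upd (upd (nth [::] [:: x; y]) 1 [::]) 0 (F x y)));
  last first.
  by [].
apply: computes_weaken.
- apply: computes_seq; first by apply: (@computes_encode _ 0 2 x).
  apply: computes_seq; first by apply: (@computes_encode _ 1 2 y); solve_upd.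
  apply: computes_seq.
    by apply: (@computes_merge _ 0 1 2 3 (str (code x)) (str (code y)));
      solve_upd.
  apply: computes_seq.
    apply: (hM _ (x, y)); first by solve_upd.
    by move=> [|[|j]] // _; solve_upd; rewrite /= nth_nil.
  by apply: (@computes_decode (F x y)); solve_upd.
- apply: leq_trans (hd (size x + size y)); rewrite /q -!/(sz _).
  have le_F : size (F x y) <= sz (F x y) by exact: leq_size_sz.
  by have := szF (x, y); have := sz_bits x; have := sz_bits y; rewrite /=; lia.
- by move=> [|[|j]]; solve_upd.
Qed.

(** * Closure properties *)

Lemma polytime_recode A B C `{Enc A} `{Enc B} `{Enc C} (f : A -> B) (f' : A ->
  C) :
  polytime f' -> (forall a, code (f a) = code (f' a)) -> polytime f.
Proof.
move=> [c [szf h]] ef; exists c; split=> [a|k]; first by rewrite /sz ef;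
  exact: szf.
have [M hM] := h k; exists M => s a sk e.
by rewrite ef; exact: hM sk e.
Qed.

Lemma polytime_cons A B `{Enc A} `{Enc B} (f : A -> B) (g : A -> seq B) :
  polytime f -> polytime g -> polytime (fun a => f a :: g a).
Proof. by move=> hf hg; apply: polytime_recode (polytime_pair hf hg) _. Qed.

Lemma polytime_Some A B `{Enc A} `{Enc B} (f : A -> B) :
  polytime f -> polytime (fun a => Some (f a)).
Proof. by move=> hf; apply: polytime_recode (polytime_pair hf (polytime_const
  tt)) _. Qed.

Lemma polytime_succ A `{Enc A} (f : A -> nat) : polytime f ->
  polytime (fun a => (f a).+1).
Proof. by move=> hf; apply: polytime_recode (polytime_pair (polytime_const tt)
  hf) _. Qed.

Lemma polytime_if A B `{Enc A} `{Enc B} (b : A -> bool) (f g : A -> B) :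
  polytime b -> polytime f -> polytime g -> polytime (fun a =>
    if b a then f a else g a).
Proof.
move=> hb hf hg; apply: (polytime_case (D := bool) (l := b) (f := g)
  (g := fun p => f p.1)) => // [a|].
  by case: (b a) => //=; exists true.
exact: (polytime_comp hf polytime_fst0).
Qed.

Lemma polytime_case_seq A B C `{Enc A} `{Enc B} `{Enc C} (l : A -> seq B) (f :
  A -> C)
    (g : A -> B -> seq B -> C) :
  polytime l -> polytime f -> polytime (fun p : A * (B * seq B) =>
    g p.1 p.2.1 p.2.2) ->
  polytime (fun a => if l a is x :: l' then g a x l' else f a).
Proof.
move=> hl hf hg; apply: (polytime_case (D := B * seq B) (l := l) (f := f)
  (g := fun p => g p.1 p.2.1 p.2.2)) => // a.
by case: (l a) => //= x l'; exists (x, l').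
Qed.

Lemma polytime_case_nat A C `{Enc A} `{Enc C} (n : A -> nat) (f : A -> C)
    (g : A -> nat -> C) :
  polytime n -> polytime f -> polytime (fun p : A * nat => g p.1 p.2) ->
  polytime (fun a => if n a is m.+1 then g a m else f a).
Proof.
move=> hn hf hg; apply: (polytime_case (D := unit * nat) (l := n) (f := f)
  (g := fun p => g p.1 p.2.2)) => // [a|].
  by case: (n a) => //= m; exists (tt, m).
apply: (polytime_comp (g := fun p => g p.1 p.2) (f := fun p => (p.1, p.2.2)))
  => //.
exact: polytime_pair polytime_fst0 (polytime_snd polytime_snd0).
Qed.

Lemma polytime_case_option A B C `{Enc A} `{Enc B} `{Enc C} (o : A -> option B)
    (f : A -> C) (g : A -> B -> C) :
  polytime o -> polytime f -> polytime (fun p : A * B => g p.1 p.2) ->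
  polytime (fun a => if o a is Some x then g a x else f a).
Proof.
move=> ho hf hg; apply: (polytime_case (D := B * unit) (l := o) (f := f)
  (g := fun p => g p.1 p.2.1)) => // [a|].
  by case: (o a) => //= x; exists (x, tt).
apply: (polytime_comp (g := fun p => g p.1 p.2) (f := fun p => (p.1, p.2.1)))
  => //.
exact: polytime_pair polytime_fst0 (polytime_fst polytime_snd0).
Qed.

Lemma polytime_foldl A S X `{Enc A} `{Enc S} `{Enc X} (f : A -> S -> X -> S)
    (s0 : A -> S) (l : A -> seq X) q :
  polytime (fun p : A * (S * X) => f p.1 p.2.1 p.2.2) -> polytime s0 ->
    polytime l ->
  polyb q -> (forall a s x, sz (f a s x) <= sz s + q (sz a + sz x)) ->
  polytime (fun a => foldl (f a) (s0 a) (l a)).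
Proof.
move=> hf hs hl [c hq] szf.
pose step (st : A * (S * seq X)) :=
  if st.2.2 is x :: l' then (st.1, (f st.1 st.2.1 x, l')) else st.
have stepE a s (l1 : seq X) n : size l1 <= n ->
    iter n step (a, (s, l1)) = (a, (foldl (f a) s l1, [::])).
  elim: n l1 s => [|n IH] [|x l1] s //= le_n; last by rewrite -iterS iterSr IH.
  by rewrite IH.
have szstep n a s (l1 : seq X) : sz (iter n step (a, (s, l1))) <=
    sz (a, (s, l1)) + n * poly_bound c (sz a + sz l1).
  elim: n s l1 => [|n IH] s l1; first by rewrite addn0.
  rewrite iterSr; case: l1 => [|x l1] /=.
    by apply: leq_trans (IH s [::]) _; rewrite leq_add2l leq_mul2r leqnSn orbT.
  rewrite [step _]/=; apply: leq_trans (IH _ l1) _; rewrite !sz_pair !sz_cons.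
  have : q (sz a + sz x) <= poly_bound c (sz a + sz x) by exact: hq.
  have := szf a s x.
  have : poly_bound c (sz a + sz x) <= poly_bound c (sz a + (sz x + sz l1).+1).
    by apply: poly_bound_mono; lia.
  have : poly_bound c (sz a + sz l1) <= poly_bound c (sz a + (sz x + sz l1).+1).
    by apply: poly_bound_mono; lia.
  move: (poly_bound c (sz a + (sz x + sz l1).+1)) => N.
  move=> /(leq_mul (leqnn n)); rewrite mulSn /=; lia.
have PTstep : polytime step.
  apply: (polytime_case_seq (g := fun st x l' => (st.1, (f st.1 st.2.1 x,
    l')))).
  - exact: polytime_snd polytime_snd0.
  - exact: polytime_id.
  - apply: polytime_pair; first exact: polytime_fst polytime_fst0.
    apply: polytime_pair; last exact: polytime_snd polytime_snd0.
    apply: (polytime_comp (f := fun p => (p.1.1, (p.1.2.1, p.2.1))) hf).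
    by apply: polytime_pair; [exact: polytime_fst polytime_fst0 | apply:
      polytime_pair;
      [exact: polytime_fst (polytime_snd polytime_fst0)
        | exact: polytime_fst polytime_snd0]].
have [c2 hc2] : polyb (fun n => n + n * poly_bound c n) by polyb.
have PTl := polytime_loop (B := seq X) (c := c2) PTstep.
apply: (@polytime_eq _ _ _ _ (fun a => (iter (sz (l a)) step (a, (s0 a,
  l a))).2.1)).
  by move=> a; rewrite stepE // leq_size_sz.
apply: polytime_fst; apply: polytime_snd.
apply: (polytime_comp (f := fun a => ((a, (s0 a, l a)), l a))
                (g := fun p => iter (sz p.2) step p.1)); last first.
  by apply: polytime_pair (hl); apply: polytime_pair;
    [exact: polytime_id | exact: polytime_pair hs hl].
apply: PTl => -[a [s l1]] n; apply: leq_trans (hc2 _).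
apply: leq_trans (szstep n a s l1) _.
apply: leq_add; first exact: leq_addr.
apply: leq_mul; first exact: leq_addl.
by apply: poly_bound_mono; rewrite !sz_pair; lia.
Qed.

Lemma polytime_iter A S `{Enc A} `{Enc S} (f : A -> S -> S) (s0 : A -> S)
    (n : A -> nat) q :
  polytime (fun p : A * S => f p.1 p.2) -> polytime s0 -> polytime n ->
  polyb q -> (forall a s, sz (f a s) <= sz s + q (sz a)) ->
  polytime (fun a => iter (n a) (f a) (s0 a)).
Proof.
move=> hf hs hn [c hq] szf.
apply: (@polytime_eq _ _ _ _ (fun a =>
  foldl (fun s (_ : unit) => f a s) (s0 a) (nseq (n a) tt))).
  move=> a; elim: (n a) (s0 a) => //= m IH s.
  by rewrite IH -iterSr.
apply: (polytime_foldl (f := fun a s (_ : unit) => f a s) (q := poly_bound c))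
  => //.
- apply: (polytime_comp (g := fun p => f p.1 p.2) (f := fun p => (p.1, p.2.1)))
    => //.
  exact: polytime_pair polytime_fst0 (polytime_fst polytime_snd0).
- apply: polytime_recode hn _ => a; elim: (n a) => // m IH;
    exact: (congr1 (Node Leaf) IH).
- by exists c.
- move=> a s x; apply: leq_trans (szf a s) _; rewrite leq_add2l.
  by apply: leq_trans (hq _) _; apply: poly_bound_mono; exact: leq_addr.
Qed.

Ltac pt_base :=
  lazymatch goal with
  | |- @polytime _ _ _ _ (fun _ => ?b) => exact: (polytime_const b)
  | |- @polytime _ _ _ _ (fun a => a) => exact: polytime_id
  | |- @polytime _ _ _ _ (@fst _ _) => exact: polytime_fst0
  | |- @polytime _ _ _ _ (@snd _ _) => exact: polytime_snd0
  | |- @polytime _ _ _ _ (fun a => (@?f a).1) => apply: (polytime_fst (f := f))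
  | |- @polytime _ _ _ _ (fun a => (@?f a).2) => apply: (polytime_snd (f := f))
  | |- @polytime _ _ _ _ (fun a => (@?f a, @?g a)) =>
      apply: (polytime_pair (f := f) (g := g))
  | |- @polytime _ _ _ _ (fun a => @?f a :: @?g a) =>
      apply: (polytime_cons (f := f) (g := g))
  | |- @polytime _ _ _ _ (fun a => Some (@?f a)) => apply: (polytime_Some (f :=
      f))
  | |- @polytime _ _ _ _ (fun a => (@?f a).+1) => apply: (polytime_succ (f :=
      f))
  end.
Ltac pt_ext := fail.
Ltac pt_if := match goal with
  | |- @polytime _ _ _ _ (fun _ => if _ then _ else _) =>
      apply: polytime_if end.
Ltac pt := repeat first [assumption | pt_base | pt_if | pt_ext].

Lemma polytime_not A `{Enc A} (b : A -> bool) : polytime b ->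
  polytime (fun a => ~~ b a).
Proof.
move=> hb; apply: (@polytime_eq _ _ _ _ (fun a => if b a then false else true)).
  by move=> a; case: (b a).
by pt.
Qed.

Lemma polytime_and A `{Enc A} (b c : A -> bool) :
  polytime b -> polytime c -> polytime (fun a => b a && c a).
Proof. by move=> hb hc; apply: polytime_if hb hc _; pt. Qed.

Lemma polytime_or A `{Enc A} (b c : A -> bool) :
  polytime b -> polytime c -> polytime (fun a => b a || c a).
Proof. by move=> hb hc; apply: polytime_if hb _ hc; pt. Qed.

Lemma polytime_eqb A `{Enc A} (b c : A -> bool) :
  polytime b -> polytime c -> polytime (fun a => b a == c a).
Proof.
move=> hb hc.
apply: (@polytime_eq _ _ _ _ (fun a => if b a then c a else ~~ c a)).
  by move=> a; case: (b a); case: (c a).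
by apply: polytime_if => //; exact: polytime_not.
Qed.

Lemma polytime_rev A B `{Enc A} `{Enc B} (l : A -> seq B) :
  polytime l -> polytime (fun a => rev (l a)).
Proof.
move=> hl; apply: (polytime_comp (g := fun l => rev l)) hl.
apply: (@polytime_eq _ _ _ _ (fun l : seq B => foldl (fun s x => x :: s)
  [::] l)).
  by rewrite /rev => l0; elim: l0 [::] => //=.
apply: (polytime_foldl (f := fun _ s x => x :: s) (q := fun n => n + 1)); pt =>
  //.
  by polyb.
by move=> a s x; rewrite sz_cons; lia.
Qed.

Lemma polytime_cat A B `{Enc A} `{Enc B} (s t : A -> seq B) :
  polytime s -> polytime t -> polytime (fun a => s a ++ t a).
Proof.
move=> hs ht.
apply: (@polytime_eq _ _ _ _ (fun a => foldl (fun s x => x :: s) (t a)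
  (rev (s a)))).
  by move=> a; rewrite foldl_rev; elim: (s a) => //= x u ->.
apply: (polytime_foldl (f := fun _ s x => x :: s) (q := fun n => n + 1)); pt =>
  //.
- exact: polytime_rev.
- by polyb.
- by move=> a u x; rewrite sz_cons; lia.
Qed.

Lemma polytime_nseq A B `{Enc A} `{Enc B} (n : A -> nat) (x : A -> B) :
  polytime n -> polytime x -> polytime (fun a => nseq (n a) (x a)).
Proof.
move=> hn hx.
apply: (@polytime_eq _ _ _ _ (fun a => iter (n a) (cons (x a)) [::]));
  first by [].
have [c [szx _]] := hx.
apply: (polytime_iter (f := fun a => cons (x a)) (q := fun n =>
  poly_bound c n + 1)); pt.
- exact: (polytime_comp hx polytime_fst0).
- by polyb.
- by move=> a s; rewrite sz_cons; have := szx a; lia.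
Qed.

Lemma sz_behead A `{Enc A} (l : seq A) : sz (behead l) <= sz l.
Proof. by case: l => // x l; rewrite sz_cons /=; lia. Qed.

Lemma polytime_behead A B `{Enc A} `{Enc B} (l : A -> seq B) :
  polytime l -> polytime (fun a => behead (l a)).
Proof.
move=> hl.
apply: (polytime_case_seq (l := l) (f := fun=> [::]) (g := fun _ _ l' => l'));
  pt.
Qed.

Lemma polytime_head A B `{Enc A} `{Enc B} (x : B) (l : A -> seq B) :
  polytime l -> polytime (fun a => head x (l a)).
Proof.
move=> hl.
apply: (polytime_case_seq (l := l) (f := fun=> x) (g := fun _ y _ => y)); pt.
Qed.

Lemma polytime_drop A B `{Enc A} `{Enc B} (n : A -> nat) (l : A -> seq B) :
  polytime n -> polytime l -> polytime (fun a => drop (n a) (l a)).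
Proof.
move=> hn hl.
apply: (@polytime_eq _ _ _ _ (fun a => iter (n a) behead (l a))).
  move=> a; elim: (n a) (l a) => [|m IH] s; first by rewrite drop0.
  by rewrite iterSr IH; case: s; rewrite //= drop_nil.
apply: (polytime_iter (f := fun _ l => behead l) (q := fun=> 0)); pt.
- by apply: polytime_behead; pt.
- by polyb.
- by move=> a s; rewrite addn0 sz_behead.
Qed.

Lemma polytime_nth A B `{Enc A} `{Enc B} (x : B) (l : A -> seq B) (n : A ->
  nat) :
  polytime l -> polytime n -> polytime (fun a => nth x (l a) (n a)).
Proof.
move=> hl hn.
apply: (@polytime_eq _ _ _ _ (fun a => head x (drop (n a) (l a)))).
  by move=> a; rewrite -nth0 nth_drop addn0.
by apply: polytime_head; exact: polytime_drop.
Qed.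

Lemma polytime_size A B `{Enc A} `{Enc B} (l : A -> seq B) :
  polytime l -> polytime (fun a => size (l a)).
Proof.
move=> hl.
apply: (@polytime_eq _ _ _ _ (fun a => foldl (fun n (_ : B) => n.+1) 0 (l a))).
  by move=> a; rewrite -[RHS]addn0; elim: (l a) 0 => //= _ s IH n; rewrite IH;
    lia.
apply: (polytime_foldl (f := fun _ n _ => n.+1) (q := fun=> 2)); pt.
- by polyb.
- by move=> a s x; rewrite !sz_nat; lia.
Qed.

Lemma polytime_addn A `{Enc A} (m n : A -> nat) :
  polytime m -> polytime n -> polytime (fun a => m a + n a).
Proof.
move=> hm hn; apply: (@polytime_eq _ _ _ _ (fun a => iter (m a) succn (n a))).
  by move=> a; elim: (m a) => //= k ->.
apply: (polytime_iter (f := fun _ n => n.+1) (q := fun=> 2)); pt.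
- by polyb.
- by move=> a s; rewrite !sz_nat; lia.
Qed.

Lemma polytime_pred A `{Enc A} (n : A -> nat) : polytime n ->
  polytime (fun a => (n a).-1).
Proof.
move=> hn; apply: (@polytime_eq _ _ _ _ (fun a =>
  if n a is m.+1 then m else 0)).
  by move=> a; case: (n a).
by apply: (polytime_case_nat (n := n) (f := fun=> 0) (g := fun _ m => m)); pt.
Qed.

Lemma polytime_subn A `{Enc A} (m n : A -> nat) :
  polytime m -> polytime n -> polytime (fun a => m a - n a).
Proof.
move=> hm hn; apply: (@polytime_eq _ _ _ _ (fun a => iter (n a) predn (m a))).
  by move=> a; elim: (n a) => [|k /= ->] //=; lia.
apply: (polytime_iter (f := fun _ n => n.-1) (q := fun=> 0)); pt.
- by apply: polytime_pred; pt.
- by polyb.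
- by move=> a s; rewrite !sz_nat; lia.
Qed.

Lemma polytime_leq A `{Enc A} (m n : A -> nat) :
  polytime m -> polytime n -> polytime (fun a => m a <= n a).
Proof.
move=> hm hn.
apply: (@polytime_eq _ _ _ _ (fun a => if m a - n a is _.+1 then false else
  true)).
  by move=> a; rewrite /leq; case: (m a - n a).
apply: (polytime_case_nat (n := fun a => m a - n a) (f := fun=> true)
  (g := fun _ _ => false)); pt.
exact: polytime_subn.
Qed.

Lemma polytime_eqn A `{Enc A} (m n : A -> nat) :
  polytime m -> polytime n -> polytime (fun a => m a == n a).
Proof.
move=> hm hn; apply: (@polytime_eq _ _ _ _ (fun a => (m a <= n a)
  && (n a <= m a))).
  by move=> a; rewrite eqn_leq.
by apply: polytime_and; exact: polytime_leq.
Qed.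

Lemma polytime_take A B `{Enc A} `{Enc B} (n : A -> nat) (l : A -> seq B) :
  polytime n -> polytime l -> polytime (fun a => take (n a) (l a)).
Proof.
move=> hn hl.
apply: (@polytime_eq _ _ _ _ (fun a =>
  rev (drop (size (l a) - n a) (rev (l a))))).
  move=> a; rewrite drop_rev revK; have [le_n|gt_n] := leqP (n a) (size (l a)).
    by rewrite subKn.
  by rewrite !take_oversize //; lia.
apply: polytime_rev; apply: polytime_drop; last exact: polytime_rev.
by apply: polytime_subn => //; exact: polytime_size.
Qed.

Lemma sz_cat A `{Enc A} (s t : seq A) : sz (s ++ t) <= sz s + sz t.
Proof. by elim: s => [|y s IH] /=; rewrite ?sz_cons ?sz_nil; lia. Qed.

Lemma polytime_flatten A B C `{Enc A} `{Enc B} `{Enc C} (h : A -> B -> seq C)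
    (l : A -> seq B) :
  polytime (fun p : A * B => h p.1 p.2) -> polytime l ->
  polytime (fun a => flatten [seq h a x | x <- l a]).
Proof.
move=> hh hl.
have [c [szh _]] := hh.
apply: (@polytime_eq _ _ _ _ (fun a => foldl (fun s x => s ++ h a x)
  [::] (l a))).
  move=> a; rewrite -[RHS]cat0s; elim: (l a) [::] => [|x s IH] u /=.
    by rewrite cats0.
  by rewrite IH catA.
apply: (polytime_foldl (f := fun a s x => s ++ h a x)
  (q := fun n => poly_bound c (n + 1))); pt.
- apply: polytime_cat; pt.
  apply: (polytime_comp (g := fun p => h p.1 p.2) (f := fun p => (p.1, p.2.2)))
    => //.
  by pt.
- by polyb.
- move=> a s x; apply: leq_trans (sz_cat _ _) _; rewrite leq_add2l.
  by have := szh (a, x); rewrite sz_pair addn1.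
Qed.

Lemma polytime_eqbits A `{Enc A} (s t : A -> seq bool) :
  polytime s -> polytime t -> polytime (fun a => s a == t a).
Proof.
move=> hs ht.
pose step (st : bool * seq bool) (x : bool) :=
  if st.2 is y :: r then (st.1 && (y == x), r) else (false, st.2).
apply: (@polytime_eq _ _ _ _ (fun a => let st := foldl step (true, t a) (s a) in
  st.1 && (size st.2 == 0))).
  move=> a /=; rewrite -[RHS]andTb.
  elim: (s a) (t a) true => [|x u IH] [|y v] b //=; rewrite IH //=.
  - by rewrite andbF.
  - by rewrite -andbA [y == x]eq_sym.
have hst : polytime (fun a => foldl step (true, t a) (s a)).
  apply: (polytime_foldl (f := fun _ => step) (q := fun=> 2)); pt.
  - apply: (polytime_case_seq (l := fun p => p.2.1.2) (f := fun p => (false,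
      p.2.1.2))
      (g := fun p y r => (p.2.1.1 && (y == p.2.2), r))); pt.
    by apply: polytime_and; pt; apply: polytime_eqb; pt.
  - by polyb.
  - move=> a [b [|y r]] x; rewrite /step /= !sz_pair ?sz_cons.
      by case: b; rewrite /sz /=; lia.
    by rewrite [sz (_ && _)]/sz [sz y]/sz [sz b]/sz; case: b; case: y; case: x;
      rewrite /=; lia.
by apply: polytime_and; [pt | apply: polytime_eqn; [apply: polytime_size;
  pt | pt]].
Qed.

(** * Gates and the decoding of instances *)

Ltac pt_seq :=
  lazymatch goal with
  | |- @polytime _ _ _ _ (fun a => ~~ (@?b a)) => apply: (polytime_not (b := b))
  | |- @polytime _ _ _ _ (fun a => (@?b a) && (@?c a)) =>
      apply: (polytime_and (b := b) (c := c))
  | |- @polytime _ _ _ _ (fun a => (@?b a) || (@?c a)) =>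
      apply: (polytime_or (b := b) (c := c))
  | |- @polytime _ _ _ _ (fun a => (@?s a) ++ (@?t a)) =>
      apply: (polytime_cat (s := s) (t := t))
  | |- @polytime _ _ _ _ (fun a => rev (@?l a)) => apply: (polytime_rev (l :=
      l))
  | |- @polytime _ _ _ _ (fun a => behead (@?l a)) =>
      apply: (polytime_behead (l := l))
  | |- @polytime _ _ _ _ (fun a => head ?x (@?l a)) =>
      apply: (polytime_head x (l := l))
  | |- @polytime _ _ _ _ (fun a => size (@?l a)) => apply: (polytime_size (l :=
      l))
  | |- @polytime _ _ _ _ (fun a => nseq (@?n a) (@?x a)) =>
      apply: (polytime_nseq (n := n) (x := x))
  | |- @polytime _ _ _ _ (fun a => drop (@?n a) (@?l a)) =>
      apply: (polytime_drop (n := n) (l := l))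
  | |- @polytime _ _ _ _ (fun a => take (@?n a) (@?l a)) =>
      apply: (polytime_take (n := n) (l := l))
  | |- @polytime _ _ _ _ (fun a => nth ?x (@?l a) (@?n a)) =>
      apply: (polytime_nth x (n := n) (l := l))
  | |- @polytime _ _ _ _ (fun a => (@?m a) + (@?n a)) =>
      apply: (polytime_addn (m := m) (n := n))
  | |- @polytime _ _ _ _ (fun a => (@?m a) - (@?n a)) =>
      apply: (polytime_subn (m := m) (n := n))
  | |- @polytime _ _ _ _ (fun a => (@?m a).-1) => apply: (polytime_pred (n :=
      m))
  | |- @polytime _ _ _ _ (fun a => (@?m a) <= (@?n a)) =>
      apply: (polytime_leq (m := m) (n := n))
  end.
Ltac pt_ext ::= pt_seq.

Lemma polytime_muln A `{Enc A} (m n : A -> nat) : polytime m -> polytime n ->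
  polytime (fun a => m a * n a).
Proof.
move=> hm hn; apply: (@polytime_eq _ _ _ _ (fun a => iter (m a) (addn (n a))
  0)).
  by move=> a; rewrite iter_addn_0 mulnC.
have [c [szn _]] := hn.
apply: (polytime_iter (f := fun a => addn (n a)) (q := poly_bound c)); pt.
- exact: (polytime_comp hn polytime_fst0).
- by exists c.
- by move=> a s; have := szn a; rewrite !sz_nat; lia.
Qed.

Lemma polytime_iota A `{Enc A} (n : A -> nat) : polytime n ->
  polytime (fun a => iota 0 (n a).+1).
Proof.
move=> hn.
pose step (m : nat) (st : nat * seq nat) := (st.1.+1, (m - st.1) :: st.2).
apply: (@polytime_eq _ _ _ _ (fun a => (iter (n a).+1 (step (n a)) (0,
  [::])).2)).
  move=> a.
  suff st k : k <= (n a).+1 -> iter k (step (n a)) (0, [::]) =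
      (k, iota ((n a).+1 - k) k) by rewrite st // subnn.
  elim: k => // k IH le_k; rewrite iterS IH; last exact: ltnW.
  by rewrite /step /= subSS; congr (_, _ :: iota _ _); lia.
apply: polytime_snd.
have [c [szn _]] := hn.
apply: (polytime_iter (f := fun a => step (n a)) (q := fun k =>
  poly_bound c k + 3)).
- by rewrite /step; pt; apply: (polytime_comp hn polytime_fst0).
- by pt.
- by pt.
- by polyb.
- move=> a [k s]; rewrite /step /= !sz_pair sz_cons.
  by have := szn a; rewrite !sz_nat; lia.
Qed.

(* [Const b] stores [b] as a wire index. *)
Definition gate_tuple (g : gate) : bool * (bool * (nat * nat)) :=
  match g with
  | Const b => (false, (false, (nat_of_bool b, 0)))
  | Not i => (false, (true, (i, 0)))
  | And i j => (true, (false, (i, j)))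
  | Or i j => (true, (true, (i, j)))
  end.

#[export] Instance enc_gate_tree : Enc gate := fun g => code (gate_tuple g).

Lemma polytime_gate_tuple A `{Enc A} (g : A -> gate) :
  polytime g -> polytime (fun a => gate_tuple (g a)).
Proof. by move=> hg; apply: polytime_recode hg _. Qed.

Lemma polytime_Const A `{Enc A} (b : A -> bool) : polytime b ->
  polytime (fun a => Const (b a)).
Proof.
move=> hb; apply: (polytime_recode (f' := fun a =>
  (false, (false, (if b a then 1 else 0, 0))))); first by pt.
by move=> a; case: (b a).
Qed.

Lemma polytime_Not A `{Enc A} (i : A -> nat) : polytime i -> polytime (fun a =>
  Not (i a)).
Proof.
by move=> hi; apply: (polytime_recode (f' := fun a => (false, (true, (i a,
  0))))); pt.
Qed.

Lemma polytime_And A `{Enc A} (i j : A -> nat) :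
  polytime i -> polytime j -> polytime (fun a => And (i a) (j a)).
Proof.
move=> hi hj.
by apply: (polytime_recode (f' := fun a => (true, (false, (i a, j a))))); pt.
Qed.

Lemma polytime_Or A `{Enc A} (i j : A -> nat) :
  polytime i -> polytime j -> polytime (fun a => Or (i a) (j a)).
Proof.
move=> hi hj.
by apply: (polytime_recode (f' := fun a => (true, (true, (i a, j a))))); pt.
Qed.

Ltac pt_gate :=
  lazymatch goal with
  | |- @polytime _ _ _ _ (fun a => Const (@?b a)) =>
      apply: (polytime_Const (b := b))
  | |- @polytime _ _ _ _ (fun a => Not (@?b a)) => apply: (polytime_Not (i :=
      b))
  | |- @polytime _ _ _ _ (fun a => And (@?b a) (@?c a)) =>
      apply: (polytime_And (i := b) (j := c))
  | |- @polytime _ _ _ _ (fun a => Or (@?b a) (@?c a)) =>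
      apply: (polytime_Or (i := b) (j := c))
  | |- @polytime _ _ _ _ (fun a => (@?m a) * (@?n a)) =>
      apply: (polytime_muln (m := m) (n := n))
  | |- @polytime _ _ _ _ (fun a => gate_tuple (@?g a)) =>
      apply: (polytime_gate_tuple (g := g))
  | |- @polytime _ _ _ _ gate_tuple => exact: (polytime_gate_tuple polytime_id)
  end.
Ltac pt_ext ::= first [pt_seq | pt_gate].

Lemma polytime_gate_val : polytime (fun p : seq bool * gate =>
  gate_val p.1 p.2).
Proof.
apply: (@polytime_eq _ _ _ _ (fun p : seq bool * gate =>
  let t := gate_tuple p.2 in
  if t.1 then
    if t.2.1 then nth false p.1 t.2.2.1 || nth false p.1 t.2.2.2
    else nth false p.1 t.2.2.1 && nth false p.1 t.2.2.2
  else if t.2.1 then ~~ nth false p.1 t.2.2.1 else 1 <= t.2.2.1)).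
  by case=> w [[]|i|i j|i j].
by rewrite /=; pt.
Qed.

Lemma polytime_gates_wires A `{Enc A} (w : A -> seq bool) (gs : A -> seq gate) :
  polytime w -> polytime gs -> polytime (fun a => gates_wires (w a) (gs a)).
Proof.
move=> hw hgs.
apply: (@polytime_eq _ _ _ _ (fun a =>
  foldl (fun w g => gate_val w g :: w) (w a) (gs a))).
  by move=> a; elim: (gs a) (w a) => //= g s IH u; rewrite IH.
apply: (polytime_foldl (f := fun _ w g => gate_val w g :: w) (q := fun=> 4));
  pt.
- exact: (polytime_comp polytime_gate_val polytime_snd0).
- by polyb.
- move=> a s x; rewrite sz_cons.
  by rewrite [sz (gate_val _ _)]/sz; case: gate_val; rewrite /=; lia.
Qed.

Lemma polytime_gates_wf A `{Enc A} (k : A -> nat) (gs : A -> seq gate) :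
  polytime k -> polytime gs -> polytime (fun a => gates_wf (k a) (gs a)).
Proof.
move=> hk hgs.
pose step (st : nat * bool) g := (st.1.+1, st.2 && gate_wf st.1 g).
apply: (@polytime_eq _ _ _ _ (fun a => (foldl step (k a, true) (gs a)).2)).
  move=> a; rewrite -[RHS]andTb; elim: (gs a) (k a) true => [|g s IH] m b /=.
    by rewrite andbT.
  by rewrite IH andbA.
have PTwf : polytime (fun p : nat * gate => gate_wf p.1 p.2).
  apply: (@polytime_eq _ _ _ _ (fun p : nat * gate =>
    let t := gate_tuple p.2 in
    if t.1 then (t.2.2.1.+1 <= p.1) && (t.2.2.2.+1 <= p.1)
    else if t.2.1 then t.2.2.1.+1 <= p.1 else true)).
    by case=> m [].
  by rewrite /=; pt.
apply: polytime_snd; apply: (polytime_foldl (f := fun _ => step) (q := fun=>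
  4)); pt.
- rewrite /step; pt; apply: (polytime_comp (f := fun p => (p.2.1.1, p.2.2))
    PTwf).
  by pt.
- by polyb.
- move=> a [m b] x; rewrite /step !sz_pair !sz_nat /=.
  by rewrite /sz; case: b; case: gate_wf; rewrite /=; lia.
Qed.

Lemma polytime_enc_nat A `{Enc A} (n : A -> nat) : polytime n ->
  polytime (fun a => enc_nat (n a)).
Proof.
move=> hn.
apply: (@polytime_eq _ _ _ _ (fun a => nseq (n a) true ++ [:: false]));
  last by pt.
by move=> a; rewrite cats1.
Qed.

Lemma polytime_enc_gate A `{Enc A} (g : A -> gate) :
  polytime g -> polytime (fun a => enc_gate (g a)).
Proof.
move=> hg; apply: (polytime_comp (g := enc_gate)) hg.
apply: (@polytime_eq _ _ _ _ (fun g =>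
  let t := gate_tuple g in
  t.1 :: t.2.1 :: (if t.1 then enc_nat t.2.2.1 ++ enc_nat t.2.2.2
    else if t.2.1 then enc_nat t.2.2.1 else [:: 1 <= t.2.2.1]))).
  by case=> [[]|i|i j|i j].
by rewrite /=; pt; apply: polytime_enc_nat; pt.
Qed.

Lemma polytime_enc_gates A `{Enc A} (gs : A -> seq gate) :
  polytime gs -> polytime (fun a => enc_gates (gs a)).
Proof.
move=> hgs.
apply: (@polytime_eq _ _ _ _ (fun a =>
  flatten [seq true :: enc_gate g | g <- gs a] ++ [:: false])).
  by move=> a; rewrite cats1.
pt; apply: (polytime_flatten (h := fun _ g => true :: enc_gate g)) => //.
by pt; apply: polytime_enc_gate; pt.
Qed.

Definition parse_nat (s : seq bool) : nat * seq bool :=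
  (index false s, drop (index false s).+1 s).

Definition parse_gate (s : seq bool) : gate * seq bool :=
  let r := behead (behead s) in
  let i := parse_nat r in
  let j := parse_nat i.2 in
  if head false s then
    (if head false (behead s) then Or i.1 j.1 else And i.1 j.1, j.2)
  else if head false (behead s) then (Not i.1, i.2)
  else (Const (head false r), behead r).

Definition parse_step (st : seq gate * seq bool) : seq gate * seq bool :=
  if head false st.2 then
    let g := parse_gate (behead st.2) in (g.1 :: st.1, g.2)
  else st.

Definition parse_gates (s : seq bool) : seq gate * seq bool :=
  let st := iter (size s) parse_step ([::], s) in (rev st.1, behead st.2).

Definition raw := (nat * (seq gate * seq gate))%type.

Definition parse_raw (x : seq bool) : raw :=
  let n := parse_nat x in
  let f := parse_gates n.2 in
  (n.1, (f.1, (parse_gates f.2).1)).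

Definition enc_raw (e : raw) : seq bool :=
  enc_nat e.1 ++ enc_gates e.2.1 ++ enc_gates e.2.2.

Definition raw_wf (e : raw) : bool :=
  gates_wf e.1 e.2.1 && gates_wf e.1 e.2.2.

Definition decode (x : seq bool) : option raw :=
  let e := parse_raw x in
  if (enc_raw e == x) && raw_wf e then Some e else None.

Lemma parse_natK n s : parse_nat (enc_nat n ++ s) = (n, s).
Proof.
rewrite /parse_nat /enc_nat.
have -> : index false (rcons (nseq n true) false ++ s) = n.
  by elim: n => //= n ->.
by rewrite drop_size_cat // size_rcons size_nseq.
Qed.

Lemma polytime_index_false A `{Enc A} (l : A -> seq bool) :
  polytime l -> polytime (fun a => index false (l a)).
Proof.
move=> hl.
pose step (st : nat * bool) (b : bool) :=
  if st.2 && b then (st.1.+1, true) else (st.1, false).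
apply: (@polytime_eq _ _ _ _ (fun a => (foldl step (0, true) (l a)).1)).
  move=> a; rewrite -[RHS]add0n; elim: (l a) 0 => [|[] s IH] n /=.
  - by rewrite addn0.
  - by rewrite IH /= addnS.
  - by elim: s {IH} => //=; rewrite addn0.
apply: polytime_fst; apply: (polytime_foldl (f := fun _ => step) (q := fun=>
  4)); pt.
- by rewrite /step; pt.
- by polyb.
- by move=> a [m []] []; rewrite /step !sz_pair !sz_nat /= /sz /=; lia.
Qed.

Lemma polytime_parse_nat A `{Enc A} (l : A -> seq bool) :
  polytime l -> polytime (fun a => parse_nat (l a)).
Proof. by move=> hl; rewrite /parse_nat; pt; exact: polytime_index_false. Qed.

Ltac pt_parse :=
  lazymatch goal with
  | |- @polytime _ _ _ _ (fun a => parse_nat (@?l a)) =>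
      apply: (polytime_parse_nat (l := l))
  end.
Ltac pt_ext ::= first [pt_seq | pt_gate | pt_parse].

Lemma sz_parse_nat (s : seq bool) :
  sz (parse_nat s).1 + sz (parse_nat s).2 <= sz s + 1.
Proof.
rewrite sz_nat /parse_nat /=; elim: s => [|b s IH] //=.
rewrite sz_cons; case: b => /=; first by rewrite [sz true]/sz /=; lia.
by rewrite drop0; lia.
Qed.

#[local] Opaque parse_nat.

Lemma parse_gateK g s : parse_gate (enc_gate g ++ s) = (g, s).
Proof.
by case: g => [b|i|i j|i j]; rewrite /parse_gate /= -?catA ?parse_natK /=
  ?parse_natK.
Qed.

Lemma polytime_parse_gate A `{Enc A} (l : A -> seq bool) :
  polytime l -> polytime (fun a => parse_gate (l a)).
Proof. by move=> hl; rewrite /parse_gate /=; pt. Qed.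

Lemma sz_parse_gate (s : seq bool) :
  sz (parse_gate s).1 + sz (parse_gate s).2 <= sz s + 20.
Proof.
have szg g : sz g = sz (gate_tuple g) by [].
have e2 : sz (behead (behead s)) <= sz s.
  exact: leq_trans (sz_behead _) (sz_behead _).
have e3 : sz (behead (behead (behead s))) <= sz s.
  exact: leq_trans (sz_behead _) e2.
have szb (b : bool) : sz b <= 3 by case: b.
rewrite /parse_gate; move: (behead (behead s)) e2 e3 => r e2 e3.
have := sz_parse_nat r; have := sz_parse_nat (parse_nat r).2.
have := szb true; have := szb false; have := leq_b1 (head false r).
by case: ifP => _; case: ifP => _; rewrite szg /= !sz_pair !sz_nat; lia.
Qed.

#[local] Opaque parse_gate.

Lemma enc_gates_cons g gs :
  enc_gates (g :: gs) = true :: enc_gate g ++ enc_gates gs.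
Proof. by rewrite /enc_gates /= rcons_cat. Qed.

Lemma size_enc_gates gs : size gs < size (enc_gates gs).
Proof. by elim: gs => // g gs IH; rewrite enc_gates_cons /= size_cat; lia. Qed.

Lemma parse_gatesK gs s : parse_gates (enc_gates gs ++ s) = (gs, s).
Proof.
suff P n acc : size gs <= n -> iter n parse_step (acc, enc_gates gs ++ s) =
    (rev gs ++ acc, false :: s).
  rewrite /parse_gates P ?cats0 ?revK // size_cat.
  by have := size_enc_gates gs; lia.
elim: gs n acc => [|g gs IH] [|n] acc // le_n.
  by elim: n.+1 => //= m ->.
rewrite iterSr enc_gates_cons.
by rewrite /parse_step /= -catA parse_gateK /= IH // rev_cons cat_rcons.
Qed.

Lemma polytime_parse_gates A `{Enc A} (l : A -> seq bool) :
  polytime l -> polytime (fun a => parse_gates (l a)).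
Proof.
move=> hl.
have hst : polytime (fun a => iter (size (l a)) parse_step ([::], l a));
  last first.
  by rewrite /parse_gates; pt.
apply: (polytime_iter (f := fun _ => parse_step) (q := fun=> 30)); pt.
- by rewrite /parse_step /=; pt; apply: polytime_parse_gate; pt.
- by polyb.
- move=> _ [acc s]; rewrite /parse_step /=; case: ifP => _; last by lia.
  have le1 := sz_parse_gate (behead s).
  have le2 : sz (behead s) <= sz s by exact: sz_behead.
  by rewrite !sz_pair sz_cons; lia.
Qed.

#[local] Opaque parse_gates.

Lemma decodeE x e : (decode x = Some e) <-> (x = enc_raw e /\ raw_wf e).
Proof.
rewrite /decode; split.
  by case: ifP => // /andP[/eqP eq_x wf] [<-].
case=> -> wf; suff -> : parse_raw (enc_raw e) = e by rewrite eqxx wf.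
rewrite /parse_raw /enc_raw parse_natK /= parse_gatesK /=.
by rewrite -[enc_gates e.2.2]cats0 parse_gatesK; case: (e) => ? [].
Qed.

Lemma polytime_decode A `{Enc A} (l : A -> seq bool) :
  polytime l -> polytime (fun a => decode (l a)).
Proof.
move=> hl.
have he : polytime (fun a => parse_raw (l a)).
  rewrite /parse_raw /=; pt.
  - by apply: polytime_parse_gates; pt.
  - by apply: polytime_parse_gates; pt; apply: polytime_parse_gates; pt.
rewrite /decode /raw_wf /enc_raw; cbv zeta; pt.
- by apply: polytime_eqbits; pt; first [apply: polytime_enc_nat | apply:
    polytime_enc_gates]; pt.
- by apply: polytime_gates_wf; pt.
- by apply: polytime_gates_wf; pt.
Qed.

(** * The random walk *)

Definition eval_gates (n : nat) (gs : seq gate) (u : seq bool) : seq bool :=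
  take n (gates_wires u gs).

Definition apply_f (e : raw) (u : seq bool) := eval_gates e.1 e.2.1 u.
Definition apply_g (e : raw) (u : seq bool) := eval_gates e.1 e.2.2 u.

Definition is_sol (e : raw) (u : seq bool) : bool :=
  ~~ (apply_f e (apply_f e (apply_g e u)) == apply_f e u)
    || (apply_f e (apply_g e u) == u).

Definition next (e : raw) (u : seq bool) (b : bool) : seq bool :=
  apply_g e (if b then apply_f e (apply_g e u) else u).

Definition walk_step (e : raw) (st : bool * seq bool) (b : bool) :
    bool * seq bool :=
  if st.1 then st
  else if is_sol e st.2 then (true, st.2)
  else if is_sol e (apply_f e (apply_g e st.2)) then (true,
    apply_f e (apply_g e st.2))
  else (false, next e st.2 b).

Definition walk (e : raw) (r : seq bool) : bool * seq bool :=
  foldl (walk_step e) (false, nseq e.1 false) r.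

Lemma size_gates_wires w gs : size (gates_wires w gs) = size w + size gs.
Proof. by elim: gs w => [|g gs IH] w /=; rewrite ?IH /= ?addn0 ?addSnnS. Qed.

Lemma size_eval_gates n gs u : n <= size u + size gs ->
  size (eval_gates n gs u) = n.
Proof. by move=> le_n; rewrite size_takel // size_gates_wires. Qed.

Lemma size_apply_f e u : size u = e.1 -> size (apply_f e u) = e.1.
Proof. by move=> su; rewrite size_eval_gates // su leq_addr. Qed.

Lemma size_apply_g e u : size u = e.1 -> size (apply_g e u) = e.1.
Proof. by move=> su; rewrite size_eval_gates // su leq_addr. Qed.

Lemma size_next e u b : size u = e.1 -> size (next e u b) = e.1.
Proof.
by move=> su; rewrite size_apply_g //; case: b; rewrite // size_apply_f //
  size_apply_g.
Qed.

Lemma walk_rcons e r b : walk e (rcons r b) = walk_step e (walk e r) b.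
Proof. exact: foldl_rcons. Qed.

Lemma walk_sound e r : size (walk e r).2 = e.1 /\
  ((walk e r).1 -> is_sol e (walk e r).2).
Proof.
elim/last_ind: r => [|r b [IHs IHf]]; first by rewrite size_nseq.
rewrite walk_rcons /walk_step; case: ifP => // _.
case: ifP => // _; case: ifP => [sol_v|_] /=; last by rewrite size_next.
by split=> //; rewrite size_apply_f // size_apply_g.
Qed.

Lemma walk_stop e r r' : (walk e r).1 -> (walk e (r ++ r')).1.
Proof.
elim/last_ind: r' => [|r' b IH] found; first by rewrite cats0.
by have h := IH found; rewrite -rcons_cat walk_rcons /walk_step h.
Qed.

Lemma walk_going e r :
  ~~ (walk e r).1 -> (walk e r).2 = foldl (next e) (nseq e.1 false) r.
Proof.
elim/last_ind: r => [|r b IH] //.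
rewrite walk_rcons foldl_rcons /walk_step; case: ifP => [->//|nf_r].
by case: ifP => // _; case: ifP => // _ _ /=; rewrite IH ?nf_r.
Qed.

Lemma walk_inj e r r' : size r = size r' ->
  ~~ (walk e r).1 -> ~~ (walk e r').1 ->
  apply_f e (walk e r).2 = apply_f e (walk e r').2 -> r = r'.
Proof.
have nsol u : is_sol e u = false ->
    apply_f e (apply_f e (apply_g e u)) = apply_f e u /\ apply_f e (apply_g e u)
      != u.
  by move=> /norP[/negbNE/eqP].
have back u b : is_sol e u = false -> is_sol e (apply_f e (apply_g e u))
  = false ->
    apply_f e (apply_f e (next e u b)) = apply_f e u.
  move=> /nsol[fu _] /nsol[fv _]; rewrite /next.
  by case: b; rewrite ?fv fu.
elim/last_ind: r r' => [|r b IH] r'; first by move/esym/size0nil => ->.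
case/lastP: r' => [|r' c]; first by rewrite size_rcons.
rewrite !size_rcons => -[eq_size]; rewrite !walk_rcons /walk_step.
case: ifP => [->//|wr]; case: ifP => // su; case: ifP => // sv _.
case: ifP => [->//|wr']; case: ifP => // su'; case: ifP => // sv' _ /= eq_f.
have eq_r : r = r'.
  apply: IH; rewrite ?wr ?wr' //.
  by rewrite -(back _ b) // -(back (walk e r').2 c) // eq_f.
rewrite -eq_r in eq_f su' sv' *.
have [_ nv] := nsol _ sv.
by move: eq_f; rewrite /next; case: b; case: c => // eq_v; move: nv;
  rewrite eq_v eqxx || rewrite -eq_v eqxx.
Qed.

Lemma card_walk_going e m :
  #|[set r : m.-tuple bool | ~~ (walk e r).1]| <= 2 ^ e.1.
Proof.
have <- : #|{: e.1.-tuple bool}| = 2 ^ e.1 by rewrite card_tuple card_bool.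
pose h (r : m.-tuple bool) : e.1.-tuple bool :=
  [tuple nth false (apply_f e (walk e r).2) i | i < e.1].
rewrite -(card_in_imset (f := h)); first exact: max_card.
move=> r r'; rewrite !inE => nr nr' eq_h; apply/val_inj.
apply: (walk_inj (e := e)); rewrite ?size_tuple //.
have szw q : size (apply_f e (walk e q).2) = e.1.
  by rewrite size_apply_f //; have [] := walk_sound e q.
apply: (@eq_from_nth _ false); rewrite !szw // => i lt_i.
have := congr1 (fun t => tnth t (Ordinal lt_i)) eq_h.
by rewrite !tnth_mktuple.
Qed.

Lemma exists_sol e : exists u, size u = e.1 /\ is_sol e u.
Proof.
case: (pickP (fun r : e.1.+1.-tuple bool => (walk e r).1)) => [r fr|nf_all].
  by have [szr sol] := walk_sound e r; exists (walk e r).2; rewrite sol.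
have := card_walk_going e e.1.+1; rewrite leqNgt => /negP[].
rewrite (_ : [set r | _] = setT) ?cardsT ?card_tuple ?card_bool ?ltn_exp2l //.
by apply/setP => r; rewrite !inE nf_all.
Qed.

Ltac pt_raw :=
  lazymatch goal with
  | |- @polytime _ _ _ _ (fun a => gates_wires (@?w a) (@?s a)) =>
      apply: (polytime_gates_wires (w := w) (gs := s))
  | |- @polytime _ _ _ _ (fun a => (@?s a : seq bool) == (@?t a)) =>
      apply: (polytime_eqbits (s := s) (t := t))
  | |- @polytime _ _ _ _ (fun a => enc_nat (@?n a)) =>
      apply: (polytime_enc_nat (n := n))
  | |- @polytime _ _ _ _ (fun a => enc_gates (@?n a)) =>
      apply: (polytime_enc_gates (gs := n))
  | |- @polytime _ _ _ _ (fun a => decode (@?n a)) =>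
      apply: (polytime_decode (l := n))
  end.
Ltac pt_ext ::= first [pt_seq | pt_gate | pt_parse | pt_raw].

Lemma polytime_apply_f A `{Enc A} (e : A -> raw) (u : A -> seq bool) :
  polytime e -> polytime u -> polytime (fun a => apply_f (e a) (u a)).
Proof. by move=> he hu; rewrite /apply_f /eval_gates; pt. Qed.

Lemma polytime_apply_g A `{Enc A} (e : A -> raw) (u : A -> seq bool) :
  polytime e -> polytime u -> polytime (fun a => apply_g (e a) (u a)).
Proof. by move=> he hu; rewrite /apply_g /eval_gates; pt. Qed.

Ltac pt_fg :=
  lazymatch goal with
  | |- @polytime _ _ _ _ (fun a => apply_f (@?w a) (@?s a)) =>
      apply: (polytime_apply_f (e := w) (u := s))
  | |- @polytime _ _ _ _ (fun a => apply_g (@?w a) (@?s a)) =>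
      apply: (polytime_apply_g (e := w) (u := s))
  end.
Ltac pt_ext ::= first [pt_seq | pt_gate | pt_parse | pt_raw | pt_fg].

Lemma polytime_is_sol A `{Enc A} (e : A -> raw) (u : A -> seq bool) :
  polytime e -> polytime u -> polytime (fun a => is_sol (e a) (u a)).
Proof. by move=> he hu; rewrite /is_sol; pt. Qed.

Lemma polytime_walk A `{Enc A} (e : A -> raw) (r : A -> seq bool) :
  polytime e -> polytime r -> polytime (fun a => walk (e a) (r a)).
Proof.
move=> he hr.
apply: (polytime_comp (g := fun p => walk p.1 p.2)) (polytime_pair he hr).
rewrite /walk.
apply: (polytime_foldl (f := fun p => walk_step p.1) (q := fun n =>
  n * 4 + 9)); pt.
- by rewrite /walk_step /next; pt; apply: polytime_is_sol; pt.
- by polyb.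
- move=> [[n fg] r0] [b u] x.
  have szn : n <= sz n by rewrite sz_nat; lia.
  have szb (c : bool) : sz c <= 3 by case: c.
  have szt gs v : sz (eval_gates n gs v) <= n * 4 + 1.
    apply: leq_trans (sz_bits _) _; rewrite leq_add2r leq_mul2r /=.
    by rewrite /eval_gates size_take_min geq_minl.
  have s1 := szb true; have s0 := szb false; rewrite /walk_step.
  case: b => /=; first exact: leq_addr.
  case: ifP => _; first by rewrite !sz_pair; lia.
  case: ifP => _; rewrite !sz_pair /next /apply_f /apply_g /=.
    by have := szt fg.1 (eval_gates n fg.2 u); lia.
  by set t := (X in eval_gates _ _ X); have := szt fg.2 t; lia.
Qed.

(** * The hash circuit *)

Lemma gates_wires_cat w gs1 gs2 :
  gates_wires w (gs1 ++ gs2) = gates_wires (gates_wires w gs1) gs2.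
Proof. by elim: gs1 w => [|g gs IH] w //=. Qed.

Lemma gates_wires_suffix w gs :
  exists2 new, size new = size gs & gates_wires w gs = new ++ w.
Proof.
elim: gs w => [|g gs IH] w /=; first by exists [::].
have [new <- ->] := IH (gate_val w g :: w).
by exists (rcons new (gate_val w g)); rewrite ?size_rcons // cat_rcons.
Qed.

Lemma gates_wires_frame w z gs : gates_wf (size w) gs ->
  gates_wires (w ++ z) gs = gates_wires w gs ++ z.
Proof.
elim: gs w => [|g gs IH] w //= /andP[wf_g wf_gs].
rewrite -IH //=; congr (gates_wires (_ :: _) _).
by case: g wf_g => [b|i|i j|i j] //=; [move=> lti | move=> /andP[lti ltj] ..];
  rewrite !nth_cat ?lti ?ltj.
Qed.

Lemma eval_gates_frame n gs w : n <= size w -> gates_wf n gs ->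
  take n (gates_wires w gs) = eval_gates n gs (take n w).
Proof.
move=> le_n wf; rewrite -{1}(cat_take_drop n w) gates_wires_frame.
  rewrite takel_cat // size_gates_wires size_takel //; exact: leq_addr.
by rewrite size_takel.
Qed.

Lemma gates_wires_rcons w gs g :
  gates_wires w (rcons gs g) = gate_val (gates_wires w gs)
    g :: gates_wires w gs.
Proof. by rewrite -cats1 gates_wires_cat. Qed.

Lemma nseqS_rcons T n (x : T) : nseq n.+1 x = rcons (nseq n x) x.
Proof. by rewrite -cats1 -[[:: x]]/(nseq 1 x) -nseqD addn1. Qed.

(* Wire indices count back from the newest wire, so repeating one gate scans
   consecutive older wires. *)
Lemma gates_wires_nseq op a c g n w :
  (forall w, gate_val w g =
     op (nth false w (a + n.-1)) (nth false w (c + n.-1))) ->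
  gates_wires w (nseq n g) =
  mkseq (fun i => op (nth false w (a + i)) (nth false w (c + i))) n ++ w.
Proof.
move=> gE.
suff H k : k <= n -> gates_wires w (nseq k g) =
    mkseq (fun i => op (nth false w (a + (n - k) + i))
                       (nth false w (c + (n - k) + i))) k ++ w.
  by rewrite H // subnn !addn0.
elim: k => [|k IH] // lt_k.
rewrite nseqS_rcons gates_wires_rcons IH; last exact: ltnW.
rewrite /mkseq -[iota 0 k.+1]/(0 :: iota 1 k) map_cons (iotaDl 1 0) -map_comp.
rewrite cat_cons; congr (_ :: _ ++ _).
  rewrite gE !nth_cat !size_map size_iota.
  by do 2 (case: ltnP => ?; first lia); congr op; congr nth; lia.
by apply: eq_map => i /=; congr op; congr nth; lia.
Qed.

Definition mux (n off R : nat) : seq gate :=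
  Or R R :: nseq n (Or 0 0) ++
  nseq n (And n.-1 (n.+1 + n.-1)) ++
  nseq n (Not (n + n.-1)) ++
  nseq n (And n.-1 (n + (n + (n.+1 + off)) + n.-1)) ++
  nseq n (Or n.-1 (n + n + n.-1)).

Lemma gates_wires_mux n off R w :
  exists new, gates_wires w (mux n off R) =
    mkseq (fun i => if nth false w R then nth false w i
                    else nth false w (off + i)) n ++ new ++ w.
Proof.
rewrite /mux -cat_cons; set b := nth false w R.
have nth_blk f k u i : nth false (mkseq f k ++ u) (k + i) = nth false u i.
  by rewrite nth_cat size_mkseq ltnNge leq_addr addKn.
have nth_blk0 f k u i : i < k -> nth false (mkseq f k ++ u) i = f i.
  by move=> lt_i; rewrite nth_cat size_mkseq lt_i nth_mkseq.
have -> gs : gates_wires w ((Or R R :: nseq n (Or 0 0)) ++ gs) =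
    gates_wires (mkseq (fun=> b) n.+1 ++ w) gs.
  rewrite gates_wires_cat /= orbb -/b; congr gates_wires.
  elim: (n) => [|k IH] //.
  rewrite nseqS_rcons gates_wires_rcons IH /= orbb.
  by rewrite /mkseq /= (iotaDl 1 1) -map_comp.
set w1 := mkseq _ _ ++ w; rewrite gates_wires_cat.
rewrite (@gates_wires_nseq andb 0 n.+1) //; set w2 := mkseq _ _ ++ w1.
rewrite gates_wires_cat.
rewrite (@gates_wires_nseq (fun x _ => ~~ x) n n) //; set w3 := mkseq _ _ ++ w2.
rewrite gates_wires_cat.
rewrite (@gates_wires_nseq andb 0 (n + (n + (n.+1 + off))) (And _ _)) //.
set w4 := mkseq _ _ ++ w3.
rewrite (@gates_wires_nseq orb 0 (n + n)) //.
have [new ew4] : exists new, w4 = new ++ w.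
  by eexists; rewrite /w4 /w3 /w2 /w1 !catA; reflexivity.
exists new; rewrite -ew4; congr (_ ++ _).
suff E (i : nat) : i < n -> nth false w4 (0 + i) || nth false w4 (n + n + i) =
    if b then nth false w i else nth false w (off + i).
  by apply/eq_in_map => i; rewrite mem_iota => /andP[_]; apply: E.
move=> lt_i.
have lt_i1 : i < n.+1 by exact: ltnW.
have e1 : nth false w1 i = b by rewrite /w1 nth_blk0.
have e2 : nth false w2 i = b && nth false w i.
  by rewrite /w2 nth_blk0 // add0n e1 /w1 nth_blk.
have e3 : nth false w3 i = ~~ b by rewrite /w3 nth_blk0 // /w2 nth_blk e1.
have -> : nth false w4 (0 + i) = ~~ b && nth false w (off + i).
  by rewrite add0n /w4 nth_blk0 // add0n e3 -!addnA /w3 nth_blk /w2 nth_blk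
    /w1 nth_blk.
by rewrite -addnA /w4 nth_blk /w3 nth_blk e2; case: (b); rewrite //= orbF.
Qed.

Definition hash_step (e : raw) (R : nat) : seq gate :=
  e.2.2 ++ e.2.1 ++
  mux e.1 (size e.2.1 + size e.2.2) (size e.2.1 + size e.2.2 + R) ++ e.2.2.

Definition hash_round (e : raw) (j : nat) : seq gate :=
  hash_step e (e.1 + j * (size (hash_step e 0)).+1).

(* The [j]-th round reads input [j], which lies below the [n] constant gates,
   the gates of the previous rounds and the inputs before it. *)
Definition hash_gates (e : raw) : seq gate :=
  nseq e.1 (Const false) ++
  flatten [seq hash_round e j | j <- iota 0 e.1.+1] ++ e.2.1.

Lemma size_hash_step e R : size (hash_step e R) = size (hash_step e 0).
Proof. by rewrite /hash_step /mux !(size_cat, size_nseq, size_map,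
  =^~ cat_cons) /= !(size_cat, size_nseq). Qed.

Lemma take_hash_step e R w : raw_wf e -> e.1 <= size w ->
  take e.1 (gates_wires w (hash_step e R)) =
  next e (take e.1 w) (nth false w R).
Proof.
rewrite /raw_wf /next /apply_f /apply_g /hash_step.
move: e.1 e.2.1 e.2.2 => n gf gg /andP[wf_f wf_g] le_n.
rewrite !gates_wires_cat.
have [n1 sz1 e1] := gates_wires_suffix w gg.
have t1 := eval_gates_frame le_n wf_g.
have le_n1 : n <= size (gates_wires w gg) by rewrite size_gates_wires; lia.
have [n2 sz2 e2] := gates_wires_suffix (gates_wires w gg) gf.
have t2 := eval_gates_frame le_n1 wf_f.
set w2 := gates_wires (gates_wires w gg) gf in e2 t2 *.
have nth_w2 i : nth false w2 (size gf + size gg + i) = nth false w i.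
  by rewrite e2 e1 catA -sz1 -sz2 -size_cat nth_cat ltnNge leq_addr addKn.
have [n3 e3] := gates_wires_mux n (size gf + size gg) (size gf + size gg + R)
  w2.
rewrite eval_gates_frame //; last first.
  by rewrite e3 size_cat size_mkseq leq_addr.
congr eval_gates; rewrite e3 take_size_cat ?size_mkseq // nth_w2.
apply: (@eq_from_nth _ false).
  rewrite size_mkseq; case: ifP => _; last by rewrite size_takel.
  have sz_g : size (eval_gates n gg (take n w))
    = n by rewrite size_eval_gates // size_takel //; lia.
  by rewrite size_eval_gates // sz_g leq_addr.
rewrite size_mkseq => i lt_i; rewrite nth_mkseq // nth_w2.
case: ifP => _; last by rewrite nth_take.
by rewrite -t1 -t2 nth_take.
Qed.

Lemma hash_rounds e r k : raw_wf e -> k <= size r ->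
  let w := gates_wires r (nseq e.1 (Const false) ++
             flatten [seq hash_round e j | j <- iota 0 k]) in
  take e.1 w = foldl (next e) (nseq e.1 false) (take k r) /\
  exists2 new, size new = e.1 + k * size (hash_step e 0) & w = new ++ r.
Proof.
move=> wf; elim: k => [|k IH] le_k.
  rewrite take0 /= cats0.
  have -> : gates_wires r (nseq e.1 (Const false)) = nseq e.1 false ++ r.
    rewrite (@gates_wires_nseq (fun _ _ => false) 0 0) //; congr (_ ++ _).
    apply: (@eq_from_nth _ false); rewrite size_mkseq ?size_nseq // => i lt_i.
    by rewrite nth_mkseq // nth_nseq lt_i.
  rewrite take_size_cat ?size_nseq //; split=> //.
  by exists (nseq e.1 false) => //; rewrite size_nseq mul0n addn0.
have [] := IH (ltnW le_k); set w := gates_wires r _ => tw [new sz_new ew].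
rewrite -addn1 iotaD map_cat flatten_cat add0n /=
  cats0 catA gates_wires_cat -/w.
have le_n : e.1 <= size w by rewrite ew size_cat; lia.
rewrite take_hash_step // tw addn1 (take_nth false) // foldl_rcons; split.
  congr next; rewrite ew nth_cat sz_new mulnS ltnNge.
  rewrite (_ : _ <= _) /=; last by lia.
  by congr nth; lia.
have [new' sz_new' ->] := gates_wires_suffix w (hash_round e k).
exists (new' ++ new); last by rewrite ew catA.
by rewrite size_cat sz_new' size_hash_step sz_new mulSn; lia.
Qed.

Lemma eval_hash_gates e r : raw_wf e -> size r = e.1.+1 ->
  eval_gates e.1 (hash_gates e) r = apply_f e (foldl (next e) (nseq e.1 false)
    r).
Proof.
move=> wf sr.
have le_r : e.1.+1 <= size r by rewrite sr.
have [tw [new sz_new ew]] := hash_rounds wf le_r.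
rewrite /eval_gates /hash_gates catA gates_wires_cat eval_gates_frame.
- by rewrite tw -sr take_size.
- by rewrite ew size_cat sz_new; lia.
- by case/andP: wf.
Qed.

Lemma gates_wf_cat k gs1 gs2 :
  gates_wf k (gs1 ++ gs2) = gates_wf k gs1 && gates_wf (k + size gs1) gs2.
Proof.
elim: gs1 k => [|g gs IH] k /=; first by rewrite addn0.
by rewrite IH addSnnS andbA.
Qed.

Lemma gate_wf_leq k k' g : k <= k' -> gate_wf k g -> gate_wf k' g.
Proof.
by move=> le_k; case: g => [b|i|i j|i j] //=; [lia | move=> /andP[] ..];
  move=> ? ?; apply/andP; lia.
Qed.

Lemma gates_wf_leq k k' gs : k <= k' -> gates_wf k gs -> gates_wf k' gs.
Proof.
elim: gs k k' => //= g gs IH k k' le_k /andP[wf_g wf_gs].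
by rewrite (gate_wf_leq le_k wf_g) (IH k.+1).
Qed.

Lemma gates_wf_nseq k n g : (0 < n -> gate_wf k g) -> gates_wf k (nseq n g).
Proof.
elim: n k => //= n IH k wf; rewrite wf //=.
by apply: IH => _; apply: gate_wf_leq (wf isT).
Qed.

Lemma gates_wf_hash_step e R k : raw_wf e -> e.1 <= k -> R < k ->
  gates_wf k (hash_step e R).
Proof.
rewrite /raw_wf /hash_step.
move: e.1 e.2.1 e.2.2 => n gf gg /andP[wf_f wf_g] le_n lt_R.
rewrite /mux /= !gates_wf_cat /= !gates_wf_cat !size_nseq.
rewrite (gates_wf_leq le_n wf_g) (gates_wf_leq _ wf_f); last by lia.
rewrite (gates_wf_leq _ wf_g); last by lia.
by rewrite !gates_wf_nseq /=; lia.
Qed.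

Lemma gates_wf_hash_gates e : raw_wf e -> gates_wf e.1.+1 (hash_gates e).
Proof.
move=> wf; rewrite /hash_gates gates_wf_cat gates_wf_nseq //= size_nseq.
suff H k : k <= e.1.+1 ->
    gates_wf (e.1.+1 + e.1) (flatten [seq hash_round e j | j <- iota 0 k]) /\
    size (flatten [seq hash_round e j | j <- iota 0 k]) =
      k * size (hash_step e 0).
  have [wf_h sz_h] := H _ (leqnn _).
  rewrite -[iota 0 e.1.+1]/(0 :: iota 1 e.1) in wf_h sz_h *.
  rewrite gates_wf_cat wf_h; case/andP: wf => wf_f _.
  by apply: gates_wf_leq wf_f; lia.
elim: k => [|k IH] // lt_k; have [wf_h sz_h] := IH (ltnW lt_k).
rewrite -(addn1 k) iotaD map_cat flatten_cat add0n /=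
  cats0 gates_wf_cat wf_h /=.
rewrite size_cat sz_h size_hash_step; split; last by lia.
by apply: gates_wf_hash_step => //; rewrite ?mulnS; lia.
Qed.

(** * The two memberships *)

Lemma polytime_hash_step A `{Enc A} (e : A -> raw) (R : A -> nat) :
  polytime e -> polytime R -> polytime (fun a => hash_step (e a) (R a)).
Proof. by move=> he hR; rewrite /hash_step /mux; pt. Qed.

Lemma polytime_hash_gates A `{Enc A} (e : A -> raw) :
  polytime e -> polytime (fun a => hash_gates (e a)).
Proof.
move=> he; apply: (polytime_comp (g := hash_gates)) he.
rewrite /hash_gates; pt.
apply: polytime_flatten; last by apply: polytime_iota; pt.
rewrite /hash_round; apply: polytime_hash_step; pt.
by apply: polytime_hash_step; pt.
Qed.

Lemma circuit_evalE n m (C : circuit n m) (u : n.-tuple bool) :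
  circuit_eval C u = eval_gates m (circuit_gates C) u :> seq bool.
Proof.
have /andP[_ le_m] := circuit_wf C.
have sz : size (eval_gates m (circuit_gates C) u)
  = m by rewrite size_eval_gates // size_tuple.
apply: (@eq_from_nth _ false); rewrite size_tuple // => i lt_i.
have -> : i = Ordinal lt_i by [].
by rewrite -tnth_nth tnth_mktuple /eval_gates nth_take.
Qed.

Definition raw_of (i : nephew_instance) : raw :=
  (nephew_dim i, (circuit_gates (nephew_f i), circuit_gates (nephew_g i))).

Lemma decode_nephew i : decode (enc_nephew i) = Some (raw_of i).
Proof.
apply/decodeE; split=> //; rewrite /raw_wf.
by have /andP[-> _] := circuit_wf (nephew_f i);
  have /andP[-> _] := circuit_wf (nephew_g i).
Qed.

Lemma decode_Some x e : decode x = Some e ->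
  exists2 i, x = enc_nephew i & raw_of i = e.
Proof.
case/decodeE => ->; case: e => n [gf gg] /andP[/= wf_f wf_g].
have wf_c gs : gates_wf n gs -> gates_wf n gs && (n <= n + size gs).
  by move=> ->; rewrite leq_addr.
by exists (NephewInstance (Circuit (wf_c gf wf_f)) (Circuit (wf_c gg wf_g))).
Qed.

Definition nephew_verify (x y : seq bool) : bool :=
  if decode x is Some e then (size y == e.1) && is_sol e y
  else y == [::].

Lemma NephewE x y : Nephew x y <-> nephew_verify x y.
Proof.
rewrite /nephew_verify; split.
  case=> [[i -> [u -> sol_u]] | [no_i ->]]; last first.
    by case D: (decode x) => [e|] //; have [i /no_i] := decode_Some D.
  rewrite decode_nephew size_tuple eqxx /= /is_sol /apply_f /apply_g /=.
  rewrite -!circuit_evalE; apply/orP.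
  by case: sol_u => [/eqP ne|/eqP eq_u]; [left | right].
case D: (decode x) => [e|]; last first.
  move/eqP=> ->; right; split=> // i eq_x.
  by rewrite eq_x decode_nephew in D.
have [i eq_x <-] := decode_Some D.
case/andP=> sz_y; rewrite /is_sol /apply_f /apply_g /=.
rewrite -[y]/(tval (Tuple sz_y)) -!circuit_evalE => sol.
left; exists i => //; exists (Tuple sz_y) => //.
by case/orP: sol => [/eqP ne|/eqP eq_u]; [left => eq_f; apply: ne; rewrite eq_f
  | right; apply: val_inj].
Qed.

Lemma Nephew_TFNP : TFNP Nephew.
Proof.
split.
- move=> x; case D: (decode x) => [e|].
    have [u [sz_u sol_u]] := exists_sol e; exists u; apply/NephewE.
    by rewrite /nephew_verify D sz_u eqxx.
  by exists [::]; apply/NephewE; rewrite /nephew_verify D.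
- exists 1 => x y /NephewE; rewrite /nephew_verify /poly_bound expn1.
  case D: (decode x) => [e|]; last by move/eqP->.
  case/andP=> /eqP-> _.
  case/decodeE: D => -> _; rewrite /enc_raw size_cat size_rcons size_nseq; lia.
- exists nephew_verify; last exact: NephewE.
  apply: polytime_poly_time2; rewrite /nephew_verify; pt.
  apply: (polytime_case_option (o := fun p => decode p.1) (f := fun p =>
    p.2 == [::])
    (g := fun p e => (size p.2 == e.1) && is_sol e p.2));
    pt.
    by apply: polytime_eqn; pt.
  by apply: polytime_is_sol; pt.
Qed.

Definition nephew_walk (x r : seq bool) : option (seq bool) :=
  if decode x is Some e then
    if (walk e r).1 then Some (walk e r).2 else None
  else Some [::].

Lemma Nephew_TFZPP : TFZPP Nephew.
Proof.
split; first exact: Nephew_TFNP.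
exists nephew_walk, 1; split.
- apply: polytime_poly_time2.
  apply: (@polytime_eq _ _ _ _ (fun p => if decode p.1 is Some e then
    (if (walk e p.2).1 then true :: (walk e p.2).2 else [::]) else [:: true])).
    by move=> p; rewrite /nephew_walk; case: (decode _) => // e; case: ifP.
  apply: (polytime_case_option (o := fun p => decode p.1) (f := fun=> [:: true])
    (g := fun p e => if (walk e p.2).1 then true :: (walk e p.2).2 else [::]));
    pt; by apply: polytime_walk; pt.
- move=> x r y; rewrite /nephew_walk => def_y; apply/NephewE; move: def_y.
  rewrite /nephew_verify; case: (decode x) => [e|] => [|[<-]] //.
  case: ifP => // found [<-]; have [-> sol] := walk_sound e r.
  by rewrite eqxx sol.
- move=> x; rewrite /prob_bits /nephew_walk.
  set m := poly_bound _ _.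
  have pow_gt0 : (0 < (2 ^ m)%:R :> rat)%R by rewrite ltr0n expn_gt0.
  rewrite ler_pdivrMr // mulrAC mul1r ler_pdivlMr // -natrM ler_nat.
  case D: (decode x) => [e|]; last first.
    by rewrite (_ : [set r | _] = set0) ?cards0 //; apply/setP => r;
      rewrite !inE.
  have -> : [set r : m.-tuple bool |
      (if (walk e r).1 then Some (walk e r).2 else None) == None] =
      [set r : m.-tuple bool | ~~ (walk e r).1].
    by apply/setP => r; rewrite !inE; case: ifP.
  apply: leq_trans (leq_mul (card_walk_going e m) (_ : 3 <= 2 ^ 2)) _ => //.
  rewrite -expnD leq_exp2l // /m /poly_bound expn1.
  case/decodeE: D => -> _; rewrite /enc_raw !size_cat size_rcons size_nseq.
  by have := size_enc_gates e.2.1; have := size_enc_gates e.2.2; lia.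
Qed.

Definition hash_instance (x : seq bool) : seq bool :=
  if decode x is Some e then enc_nat e.1 ++ enc_gates (hash_gates e) else [::].

Definition nephew_of_collision (x z : seq bool) : seq bool :=
  if decode x is Some e then
    if (walk e z).1 then (walk e z).2 else (walk e (drop e.1.+1 z)).2
  else [::].

Lemma hash_collision e z : raw_wf e ->
  WeakPigeon (enc_nat e.1 ++ enc_gates (hash_gates e)) z ->
  exists r r', [/\ z = r ++ r', size r = e.1.+1, size r' = e.1.+1, r <> r'
    & eval_gates e.1 (hash_gates e) r = eval_gates e.1 (hash_gates e) r'].
Proof.
move=> wf [[[n h] eq_x [r [r' [-> ne_r eq_h]]]] | [no_i _]]; last first.
  have wf_h : gates_wf e.1.+1 (hash_gates e) &&
      (e.1 <= e.1.+1 + size (hash_gates e)).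
    by rewrite gates_wf_hash_gates //; lia.
  by case: (no_i (WeakPigeonInstance (Circuit wf_h))).
rewrite /enc_weak_pigeon /= in eq_x r r' ne_r eq_h *.
have := congr1 parse_nat eq_x; rewrite !parse_natK => -[en eg].
have := congr1 parse_gates (congr1 (cat^~ [::]) eg).
rewrite /enc_circuit !parse_gatesK => -[->]; rewrite en.
exists r, r'; rewrite !size_tuple -!circuit_evalE eq_h; split=> //.
by move/val_inj.
Qed.

Lemma Nephew_PWPP : PWPP Nephew.
Proof.
split; first exact: Nephew_TFNP.
exists hash_instance, nephew_of_collision; split.
- apply: polytime_poly_time1.
  apply: (polytime_case_option (o := decode) (f := fun=> [::])
    (g := fun _ e => enc_nat e.1 ++ enc_gates (hash_gates e))); pt.
    by apply: polytime_decode; pt.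
  by apply: polytime_hash_gates; pt.
- apply: polytime_poly_time2.
  apply: (polytime_case_option (o := fun p => decode p.1) (f := fun=> [::])
    (g := fun p e => if (walk e p.2).1 then (walk e p.2).2
                     else (walk e (drop e.1.+1 p.2)).2)); pt;
    by apply: polytime_walk; pt.
- move=> x z; rewrite /hash_instance /nephew_of_collision => wp.
  apply/NephewE; rewrite /nephew_verify.
  case D: (decode x) wp => [e|] // wp.
  have wf : raw_wf e by case/decodeE: D.
  case: ifP => [found|going].
    by have [-> ->] := walk_sound e z; rewrite ?eqxx.
  have [r [r' [eq_z sz_r sz_r' ne_r]]] := hash_collision wf wp.
  rewrite !eval_hash_gates // => eq_f.
  rewrite eq_z -sz_r drop_size_cat //.
  have [-> sol] := walk_sound e r'; rewrite eqxx /=; apply: sol.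
  apply/negPn/negP => going'; case: ne_r; apply: (@walk_inj e) => //.
  - by rewrite sz_r.
  - by apply/negP => found; rewrite eq_z walk_stop in going.
  - rewrite !walk_going //.
    by apply/negP => found; rewrite eq_z walk_stop in going.
Qed.

Theorem theorem1p5 : TFZPP Nephew /\ PWPP Nephew.
Proof. by split; [exact: Nephew_TFZPP | exact: Nephew_PWPP]. Qed.
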